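(* Let $n\ge 6$ and let $M^{1,0}$ be the $n$-dimensional complex Leibniz algebra with basis $e_1,\dots,e_n$ and products $[e_1,e_1]=e_n$, $[e_i,e_1]=e_{i+1}$ for $2\le i\le n-2$ (all other products zero). Let $R$ be an $(n+1)$-dimensional complex solvable Leibniz algebra whose nilradical is isomorphic to $M^{1,0}$. Then $R$ admits a basis $\{e_1,\dots,e_n,x\}$ in which $[e_1,e_1]=e_n$, $[e_i,e_1]=e_{i+1}$ ($2\le i\le n-2$), and the remaining products are given by one of the following tables, with complex parameters (products not listed are zero): $R_1(M^{1,0},1)(\alpha_2,\dots,\alpha_n)$: $[e_1,x]=\alpha_2e_n$; $[e_i,x]=e_i+\sum_{t=i+1}^{n-1}\alpha_{t-i+2}e_t$ for $2\le i\le n-1$; $[x,x]=\alpha_ne_n$. $R_2(M^{1,0},1)(\alpha)$: $[e_1,x]=e_1$; $[e_i,x]=(i-1)e_i$ for $2\le i\le n-1$; $[e_n,x]=2e_n$; $[x,e_1]=-e_1+\alpha e_2$. $R_3(M^{1,0},1)(\alpha)$: $[e_1,x]=e_1$; $[e_2,x]=2e_2+\alpha e_n$; $[e_i,x]=ie_i$ for $3\le i\le n-1$; $[e_n,x]=2e_n$; $[x,e_1]=-e_1$. $R_4(M^{1,0},1)(\alpha)$: $[e_1,x]=e_1+\alpha e_{n-2}$; $[e_i,x]=(i+3-n)e_i$ for $2\le i\le n-1$; $[e_n,x]=\alpha e_{n-1}+2e_n$; $[x,e_1]=-e_1$; $[x,x]=-\alpha e_{n-3}$. $R_5(M^{1,0},1)(\alpha)$: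 $[e_1,x]=e_1+\alpha e_{n-1}$; $[e_i,x]=(i+2-n)e_i$ for $2\le i\le n$; $[x,e_1]=-e_1$; $[x,x]=-\alpha e_{n-2}$. $R_6(M^{1,0},1)(\alpha)$: $[e_1,x]=e_1$; $[e_i,x]=(i+1-n)e_i$ for $2\le i\le n-1$; $[e_n,x]=2e_n$; $[x,e_1]=-e_1$; $[x,x]=\alpha e_{n-1}$. $R_7(M^{1,0},1)(\alpha)$: $[e_1,x]=e_1$; $[e_i,x]=(i-2+\alpha)e_i$ for $2\le i\le n-1$; $[e_n,x]=2e_n$; $[x,e_1]=-e_1$; where $\alpha\notin\{1,2,3-n,4-n,5-n\}$.
   Context: All algebras are finite-dimensional over $\mathbb{C}$. A (right) Leibniz algebra is a vector space with a bilinear bracket satisfying $[x,[y,z]]=[[x,y],z]-[[x,z],y]$. With $L^{[1]}=L$, $L^{[s+1]}=[L^{[s]},L^{[s]}]$ and $L^1=L$, $L^{k+1}=[L^k,L]$, the algebra $L$ is solvable if some $L^{[m]}=0$ and nilpotent if some $L^k=0$. The nilradical of a Leibniz algebra is its maximal nilpotent ideal. *)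

(* Defs.v *)
From HB Require Import structures.
From mathcomp Require Import all_boot all_order all_algebra.

Set Implicit Arguments.
Unset Strict Implicit.
Unset Printing Implicit Defensive.

Import GRing.Theory.
Local Open Scope ring_scope.

HB.mixin Record Vector_isLeibniz (K : fieldType) L of Vector K L := {
  lbr : L -> L -> L;
  lbr_linear_l : forall v : L, linear (fun u => lbr u v);
  lbr_linear_r : forall u : L, linear (lbr u);
  lbr_leibniz : forall x y z : L,
    lbr x (lbr y z) = lbr (lbr x y) z - lbr (lbr x z) y
}.

#[short(type="leibnizType")]
HB.structure Definition Leibniz (K : fieldType) :=
  {L of Vector_isLeibniz K L & Vector K L}.

Notation "[ 'lb' u , v ]" := (lbr u v)
  (at level 0, u, v at level 99, format "[ 'lb'  u ,  v ]") : ring_scope.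

Section Theory.
Variables (K : fieldType) (L : leibnizType K).
Implicit Types (U V W N : {vspace L}).

Definition rlbr (v u : L) : L := [lb u, v].

HB.instance Definition _ (u : L) :=
  GRing.isLinear.Build K L L _ (lbr u) (lbr_linear_r u).
HB.instance Definition _ (v : L) :=
  GRing.isLinear.Build K L L _ (rlbr v) (lbr_linear_l v).

(* The product of two subspaces, i.e. the span of all brackets; by            *)
(* bilinearity the brackets of basis vectors suffice, see [lbrv_subvP].       *)
Definition lbrv U V : {vspace L} :=
  <<[seq [lb u, v] | u <- vbasis U, v <- vbasis V]>>%VS.

Lemma lbrv_subvP U V W :
  reflect (forall u v, u \in U -> v \in V -> [lb u, v] \in W) (lbrv U V <= W)%VS.
Proof.
apply: (iffP span_subvP) => [sW u v uU vV | sW w]; last first.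
  by case/allpairsP=> -[u v] [/= /vbasis_mem uU /vbasis_mem vV ->]; exact: sW.
rewrite -[[lb _, _]]/(rlbr v u) (coord_vbasis uU) linear_sum memv_suml // => i _.
rewrite linearZ memvZ //= /rlbr.
rewrite (coord_vbasis vV) linear_sum memv_suml // => j _.
rewrite linearZ memvZ //= sW //; apply/allpairsP.
exists ((vbasis U)`_i, (vbasis V)`_j).
by split; rewrite //= mem_nth ?size_tuple.
Qed.

(* The indices of both series are shifted by one: index 0 is the term L^[1],  *)
(* resp. L^1, of the mathematical numbering.                                  *)
Fixpoint derived_series U (s : nat) : {vspace L} :=
  if s is s'.+1 then lbrv (derived_series U s') (derived_series U s') else U.

Fixpoint lower_central_series U (k : nat) : {vspace L} :=
  if k is k'.+1 then lbrv (lower_central_series U k') U else U.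

Definition leibniz_solvable U : Prop := exists m, derived_series U m = 0%VS.
Definition leibniz_nilpotent U : Prop :=
  exists k, lower_central_series U k = 0%VS.

Definition leibniz_ideal U : Prop :=
  forall u x : L, u \in U -> [lb u, x] \in U /\ [lb x, u] \in U.

Definition leibniz_nilradical N : Prop :=
  [/\ leibniz_ideal N, leibniz_nilpotent N
    & forall I : {vspace L}, leibniz_ideal I -> leibniz_nilpotent I ->
        (N <= I)%VS -> I = N].

(* The subalgebra N of L is isomorphic to M: an isomorphism from M onto N is  *)
(* given as an injective morphism M -> L with image N.                        *)
Definition subalg_isomorphic N (M : leibnizType K) : Prop :=
  exists f : 'Hom(M, L),
    [/\ lker f = 0%VS, limg f = N
      & forall u v : M, f [lb u, v] = [lb f u, f v]].

End Theory.

Section M10.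

(* Here and below basis vectors are numbered from 1, as e 1, ..., e n.        *)
Definition M10_prod (V : zmodType) (n : nat) (e : nat -> V) (i j : nat) : V :=
  if j == 1%N then
    if i == 1%N then e n
    else if (2 <= i <= n - 2)%N then e i.+1 else 0
  else 0.

Variables (K : fieldType) (n : nat).

Definition M10_basis (k : nat) : 'rV[K]_n := \row_(j < n) (j.+1 == k)%:R.

Definition M10_lbr (u v : 'rV[K]_n) : 'rV[K]_n :=
  \sum_(i < n) \sum_(j < n)
    (u 0 i * v 0 j) *: M10_prod n M10_basis i.+1 j.+1.

Lemma M10_lbr_linear_l v : linear (fun u => M10_lbr u v).
Proof.
move=> a u w; rewrite /M10_lbr scaler_sumr -big_split; apply: eq_bigr => i _.
rewrite scaler_sumr -big_split; apply: eq_bigr => j _ /=.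
by rewrite !mxE mulrDl scalerDl scalerA mulrA.
Qed.

Lemma M10_lbr_linear_r u : linear (M10_lbr u).
Proof.
move=> a v w; rewrite /M10_lbr scaler_sumr -big_split; apply: eq_bigr => i _.
rewrite scaler_sumr -big_split; apply: eq_bigr => j _ /=.
by rewrite !mxE mulrDr scalerDl scalerA mulrCA.
Qed.

Lemma M10_lbrE i j : (0 < i <= n)%N -> (0 < j <= n)%N ->
  M10_lbr (M10_basis i) (M10_basis j) = M10_prod n M10_basis i j.
Proof.
case: i => // i /= lti; case: j => // j /= ltj.
rewrite /M10_lbr (bigD1 (Ordinal lti)) //= (bigD1 (Ordinal ltj)) //=.
rewrite !mxE !eqxx mulr1 scale1r !big1 ?addr0 // => [k nk | k nk].
  apply: big1 => l _; rewrite !mxE eqSS; move: nk.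
  by rewrite -val_eqE /= => /negPf->; rewrite mul0r scale0r.
rewrite !mxE !eqSS; move: nk.
by rewrite -val_eqE /= => /negPf->; rewrite mulr0 scale0r.
Qed.

Hypothesis n_ge6 : (6 <= n)%N.

Lemma M10_lbr_leibniz (x y z : 'rV[K]_n) :
  M10_lbr x (M10_lbr y z) = M10_lbr (M10_lbr x y) z - M10_lbr (M10_lbr x z) y.
Proof.
have n0 : (0 < n)%N by apply: leq_trans n_ge6.
pose o := Ordinal n0.
pose T (u : 'rV[K]_n) : 'rV[K]_n := \sum_(i < n) u 0 i *: M10_prod n M10_basis i.+1 1.
have lbrE (u v : 'rV[K]_n) : M10_lbr u v = v 0 o *: T u.
  rewrite /M10_lbr scaler_sumr; apply: eq_bigr => i _.
  rewrite (bigD1 o) //= big1 ?addr0 ?scalerA 1?[v 0 o * _]mulrC // => j.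
  by rewrite -val_eqE /= /M10_prod eqSS => /negPf->; rewrite scaler0.
have TZ a (u : 'rV[K]_n) : T (a *: u) = a *: T u.
  by rewrite /T scaler_sumr; apply: eq_bigr => i _; rewrite mxE scalerA.
have T0 (u : 'rV[K]_n) : T u 0 o = 0.
  have n1 : (1%N == n) = false by rewrite ltn_eqF // (leq_trans _ n_ge6).
  rewrite summxE big1 // => i _; rewrite mxE /M10_prod eqxx.
  case: (_ == _); first by rewrite mxE /= n1 mulr0.
  by case: (_ <= _ <= _)%N; rewrite mxE ?mulr0.
rewrite !lbrE mxE T0 mulr0 scale0r !TZ !scalerA mulrC.
by rewrite subrr.
Qed.

Definition M10 of (6 <= n)%N : Type := 'rV[K]_n.

HB.instance Definition _ := Vector.on (M10 n_ge6).
HB.instance Definition _ := Vector_isLeibniz.Build K (M10 n_ge6)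
  M10_lbr_linear_l M10_lbr_linear_r M10_lbr_leibniz.

End M10.

Arguments M10 : clear implicits.

(* The products involving x in a one-dimensional extension with basis         *)
(* e 1, ..., e n, x: [e_i, x], [x, e_j] and [x, x].                           *)
Record ext_table (V : Type) := ExtTable {
  ext_ex : nat -> V;
  ext_xe : nat -> V;
  ext_xx : V
}.

Definition basis_with_products (K : fieldType) (L : leibnizType K) (n : nat)
    (e : nat -> L) (x : L) (t : ext_table L) : Prop :=
  [/\ basis_of {:L} (rcons [seq e i | i <- iota 1 n] x),
      forall i j, (1 <= i <= n)%N -> (1 <= j <= n)%N ->
        [lb e i, e j] = M10_prod n e i j,
      forall i, (1 <= i <= n)%N -> [lb e i, x] = ext_ex t i,
      forall j, (1 <= j <= n)%N -> [lb x, e j] = ext_xe t j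
    & [lb x, x] = ext_xx t].

Section Tables.
Variables (K : fieldType) (V : lmodType K) (n : nat) (e : nat -> V).

(* Only the values a 2, ..., a n of the parameter sequence are used.          *)
Definition R1_table (a : nat -> K) : ext_table V := ExtTable
  (fun i => if i == 1%N then a 2%N *: e n
            else if (2 <= i <= n - 1)%N then
              e i + \sum_(i.+1 <= t < n) a (t - i + 2)%N *: e t
            else 0)
  (fun=> 0)
  (a n *: e n).

Definition R2_table (a : K) : ext_table V := ExtTable
  (fun i => if i == 1%N then e 1%N
            else if (2 <= i <= n - 1)%N then (i%:R - 1) *: e i
            else if i == n then 2 *: e n else 0)
  (fun j => if j == 1%N then - e 1%N + a *: e 2%N else 0)
  0.

Definition R3_table (a : K) : ext_table V := ExtTable
  (fun i => if i == 1%N then e 1%N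
            else if i == 2%N then 2 *: e 2%N + a *: e n
            else if (3 <= i <= n - 1)%N then i%:R *: e i
            else if i == n then 2 *: e n else 0)
  (fun j => if j == 1%N then - e 1%N else 0)
  0.

Definition R4_table (a : K) : ext_table V := ExtTable
  (fun i => if i == 1%N then e 1%N + a *: e (n - 2)%N
            else if (2 <= i <= n - 1)%N then (i%:R + 3 - n%:R) *: e i
            else if i == n then a *: e (n - 1)%N + 2 *: e n else 0)
  (fun j => if j == 1%N then - e 1%N else 0)
  (- (a *: e (n - 3)%N)).

Definition R5_table (a : K) : ext_table V := ExtTable
  (fun i => if i == 1%N then e 1%N + a *: e (n - 1)%N
            else if (2 <= i <= n)%N then (i%:R + 2 - n%:R) *: e i else 0)
  (fun j => if j == 1%N then - e 1%N else 0)
  (- (a *: e (n - 2)%N)).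

Definition R6_table (a : K) : ext_table V := ExtTable
  (fun i => if i == 1%N then e 1%N
            else if (2 <= i <= n - 1)%N then (i%:R + 1 - n%:R) *: e i
            else if i == n then 2 *: e n else 0)
  (fun j => if j == 1%N then - e 1%N else 0)
  (a *: e (n - 1)%N).

Definition R7_table (a : K) : ext_table V := ExtTable
  (fun i => if i == 1%N then e 1%N
            else if (2 <= i <= n - 1)%N then (i%:R - 2 + a) *: e i
            else if i == n then 2 *: e n else 0)
  (fun j => if j == 1%N then - e 1%N else 0)
  0.

End Tables.

(* Main.v *)
(* Let e_1, ..., e_n be the given basis of N and x a vector outside N. Right  *)
(* multiplication by x is a derivation of N, so it is triangular with         *)
(* eigenvalues a on e_1, b + (i - 2) a on e_i for 2 <= i <= n - 1, and 2 a on *)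
(* e_n. If a = b = 0 then the whole algebra is nilpotent, against the         *)
(* maximality of N; so x can be rescaled to make (a, b) equal to (0, 1) or    *)
(* (1, b). As all [u, v] + [v, u] lie in the right annihilator, [x, e_j] = 0  *)
(* for j >= 2. Changes of e_1, e_2 and x then remove every remaining          *)
(* structure constant except at coincidences of eigenvalues: (0, 1) leads to  *)
(* R_1, and (1, b) to R_2, ..., R_6 for b = 1, 2, 5 - n, 4 - n, 3 - n         *)
(* respectively and to R_7 for other b.                                       *)
Require Import Defs.
From HB Require Import structures.
From mathcomp Require Import all_boot all_order all_algebra.
From mathcomp Require Import reals.
From mathcomp Require Import complex.
From mathcomp Require Import zify ring.

Set Implicit Arguments.
Unset Strict Implicit.
Unset Printing Implicit Defensive.
Import GRing.Theory Num.Theory.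
Local Open Scope ring_scope.

(** Right multiplications are derivations ([lb_derivation]) and e_1, e_2 generate N, so [e_1, x] and
    [e_2, x] determine the right action of x on N. Differentiating the relations [e_1, e_2] = 0 and
    [e_n, e_1] = 0 makes this action triangular, with diagonal governed by the weights a of e_1 and
    b of e_2 ([lb_e1x], [lb_enx], [co_eix], [con_eix]). On the left, [x, .] kills all squares and
    symmetrised brackets, so only [x, e_1] survives ([lb_xej_ge3], [lb_xe2]), and
    [lb_xe1_constraint] ties it to [x, x]. The weights do not both vanish, by [nonnilpotent_ext].

    Two freedoms remain: new generators e_1 + u, e_2 + v ([frame_change]), and x - y with y in N
    ([ext_shift]). They move a structure constant by multiples of a difference of eigenvalues, so it
    can be removed unless that difference is zero. For a = 1 the constants A, B, g, c, s are left,
    with products A (b + n - 5), B (b + n - 4), g (b - 2), c (b - 1), s (b + n - 3) all zero. As n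
    >= 6 the five roots are distinct, so at most one constant is nonzero ([R2_7_table_products]).
    For a = 0, b = 1 the differences along e_2, ..., e_(n-1) vanish, and the row of e_2 supplies the
    parameters of R_1 ([R1_table_products]). *)

Section BracketTheory.
Variables (K : fieldType) (L : leibnizType K).
Implicit Types u v w : L.

Lemma lbDl u v w : [lb u + v, w] = [lb u, w] + [lb v, w].
Proof. exact: (linearD (rlbr w)). Qed.
Lemma lbDr u v w : [lb w, u + v] = [lb w, u] + [lb w, v].
Proof. exact: (linearD (lbr w)). Qed.
Lemma lbNl u v : [lb - u, v] = - [lb u, v].
Proof. exact: (linearN (rlbr v)). Qed.
Lemma lbNr u v : [lb u, - v] = - [lb u, v].
Proof. exact: (linearN (lbr u)). Qed.
Lemma lbZl a u v : [lb a *: u, v] = a *: [lb u, v].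
Proof. exact: (linearZ_LR (rlbr v)). Qed.
Lemma lbZr a u v : [lb u, a *: v] = a *: [lb u, v].
Proof. exact: (linearZ_LR (lbr u)). Qed.
Lemma lb0l u : [lb 0, u] = 0.
Proof. exact: (linear0 (rlbr u)). Qed.
Lemma lb0r u : [lb u, 0] = 0.
Proof. exact: (linear0 (lbr u)). Qed.
Lemma lb_suml (I : Type) (r : seq I) (P : pred I) (F : I -> L) v :
  [lb \sum_(i <- r | P i) F i, v] = \sum_(i <- r | P i) [lb F i, v].
Proof. exact: (linear_sum (rlbr v)). Qed.
Lemma lb_sumr (I : Type) (r : seq I) (P : pred I) (F : I -> L) v :
  [lb v, \sum_(i <- r | P i) F i] = \sum_(i <- r | P i) [lb v, F i].
Proof. exact: (linear_sum (lbr v)). Qed.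
Definition lbE := (lbDl, lbDr, lbNl, lbNr, lbZl, lbZr, lb0l, lb0r).

Lemma lb_derivation u v w : [lb [lb u, v], w] = [lb [lb u, w], v] + [lb u, [lb v, w]].
Proof. by rewrite lbr_leibniz addrC subrK. Qed.

(** The Leibniz identity makes [u, [v, w]] antisymmetric in v and w. *)
Lemma lb_symr0 u v w : [lb u, [lb v, w] + [lb w, v]] = 0.
Proof. by rewrite lbDr !lbr_leibniz addrC addrA subrK subrr. Qed.

Lemma lb_sqr0 u v : [lb u, [lb v, v]] = 0.
Proof. by rewrite lbr_leibniz subrr. Qed.

Lemma scalar_ext (u v : L) : (forall f : {scalar L}, f u = f v) -> u = v.
Proof.
move=> eq_f; rewrite (coord_vbasis (memvf u)) (coord_vbasis (memvf v)).
by apply: eq_bigr => i _; rewrite (eq_f (coord _ i)).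
Qed.

End BracketTheory.

(* Linear identities in a vector space, checked on all scalar forms.          *)
Ltac vring :=
  apply: scalar_ext => ?; rewrite !(linearD, linearN, linear0, linearZ) /=; ring.

(** * Frames: bases of N with the products of M^{1,0}, and their coordinates *)

Section Frames.
Variables (K : numFieldType) (n : nat) (L : leibnizType K) (N : {vspace L}).
Hypothesis n_ge6 : (6 <= n)%N.
Implicit Types (e : nat -> L) (u v x y : L).

Definition M10_frame e : Prop :=
  basis_of N [seq e i | i <- iota 1 n] /\
  (forall i j, (1 <= i <= n)%N -> (1 <= j <= n)%N ->
     [lb e i, e j] = M10_prod n e i j).

Fact n_gt0 : (0 < n)%N. Proof. by lia. Qed.

(* The coordinate along e_i; meaningful for u in N and 1 <= i <= n only.      *)
Definition co e (i : nat) u : K :=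
  coord [tuple e j.+1 | j < n] (insubd (Ordinal n_gt0) i.-1) u.

Fact co_is_scalar e i : scalar (co e i).
Proof. by move=> a u v; rewrite /co linearP. Qed.
HB.instance Definition _ e i :=
  GRing.isLinear.Build K L K *%R (co e i) (co_is_scalar e i).

Arguments co : simpl never.

Section Coordinates.
Variable e : nat -> L.
Hypothesis fr : M10_frame e.

Lemma frame_mktuple : [tuple e j.+1 | j < n] = [seq e i | i <- iota 1 n] :> seq L.
Proof.
rewrite /= -[map _ (enum _)]/(map ((fun i => e i.+1) \o val) (enum 'I_n)).
by rewrite map_comp val_enum_ord (iotaDl 1 0) -map_comp.
Qed.

Lemma frame_basis : basis_of N [tuple e j.+1 | j < n].
Proof. by rewrite frame_mktuple; case: fr. Qed.

Lemma frame_mem i : (1 <= i <= n)%N -> e i \in N.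
Proof.
move=> hi; have [bas _] := fr; apply: (basis_mem bas).
by apply: map_f; rewrite mem_iota; lia.
Qed.

Lemma co_frame i j : (1 <= i <= n)%N -> (1 <= j <= n)%N ->
  co e i (e j) = (i == j)%:R.
Proof.
move=> hi hj; have jn : (j.-1 < n)%N by lia.
have -> : e j = [tuple e j.+1 | j < n]`_(Ordinal jn).
  by rewrite -tnth_nth tnth_mktuple /= prednK //; lia.
rewrite /co (coord_free (Ordinal jn) _ (basis_free frame_basis)).
by rewrite -val_eqE val_insubd /=; case: ifP => ?; congr (nat_of_bool _)%:R; lia.
Qed.

Lemma co_expand u : u \in N -> u = \sum_(1 <= i < n.+1) co e i u *: e i.
Proof.
move=> /(coord_basis frame_basis) {1}->.
rewrite big_add1 big_mkord; apply: eq_bigr => i _.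
rewrite -(tnth_nth 0 [tuple e j.+1 | j < n]) tnth_mktuple; congr (_ *: _).
by rewrite /co; congr (coord _ _ _); apply: val_inj; rewrite val_insubd /= ltn_ord.
Qed.

Lemma co_inj u v : u \in N -> v \in N ->
  (forall i, (1 <= i <= n)%N -> co e i u = co e i v) -> u = v.
Proof.
move=> uN vN eq_uv; rewrite (co_expand uN) (co_expand vN).
by apply: eq_big_nat => i hi; rewrite eq_uv.
Qed.

Lemma co_support (S : seq nat) u : u \in N -> uniq S ->
    {in S, forall i, 1 <= i <= n}%N ->
    (forall i, (1 <= i <= n)%N -> i \notin S -> co e i u = 0) ->
  u = \sum_(i <- S) co e i u *: e i.
Proof.
move=> uN uniqS hS zS; rewrite [LHS](co_expand uN) (bigID (mem S)) /=.
rewrite [X in _ + X]big_nat_cond [X in _ + X]big1 ?addr0; last first.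
  by move=> i /andP[hi iS]; rewrite zS // scale0r.
rewrite -big_filter; apply: perm_big; apply: uniq_perm => //.
  by rewrite filter_uniq // iota_uniq.
move=> i; rewrite mem_filter mem_index_iota.
by case iS: (i \in S) => //=; have := hS i iS; lia.
Qed.

Lemma co_exists (f : nat -> K) :
  exists2 u, u \in N & forall i, (1 <= i <= n)%N -> co e i u = f i.
Proof.
exists (\sum_(1 <= i < n.+1) f i *: e i).
  by rewrite big_nat_cond memv_suml // => i /andP[hi _]; rewrite memvZ ?frame_mem.
move=> i hi; rewrite linear_sum /= (@eq_big_nat _ _ _ _ _ _ (fun j => if j == i then f i else 0)).
  by rewrite -big_mkcond big_nat1_eq; case: ifP => //; lia.
move=> j hj; rewrite linearZ /= co_frame //.
by rewrite eq_sym; case: eqP => [->|_]; rewrite ?mulr1 ?mulr0.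
Qed.

(** Only e_1 acts nontrivially from the right, so just the e_1 coordinate of v counts. *)
Lemma frame_lbE u v : u \in N -> v \in N -> [lb u, v] = co e 1 v *: [lb u, e 1%N].
Proof.
move=> uN vN; rewrite {1}(co_expand uN) {2}(co_expand uN) !lb_suml scaler_sumr.
apply: eq_big_nat => i hi; rewrite !lbZl scalerA mulrC -scalerA; congr (_ *: _).
rewrite {1}(co_expand vN) lb_sumr big_nat_recl //; last by lia.
rewrite [X in _ + X]big_nat_cond [X in _ + X]big1 ?addr0 ?lbZr // => j hj.
have [_ prods] := fr; rewrite lbZr prods; try lia.
by rewrite /M10_prod ifN ?scaler0 //; lia.
Qed.

Lemma frame_lb1 : [lb e 1%N, e 1%N] = e n.
Proof. by have [_ ->] := fr; rewrite //; lia. Qed.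

Lemma frame_lbS i : (2 <= i <= n - 2)%N -> [lb e i, e 1%N] = e i.+1.
Proof.
move=> hi; have [_ ->] := fr; try lia.
by rewrite /M10_prod /= ifN ?hi //; lia.
Qed.

Lemma frame_lb0 i : (n - 1 <= i <= n)%N -> [lb e i, e 1%N] = 0.
Proof.
move=> hi; have [_ ->] := fr; try lia.
by rewrite /M10_prod /= !ifN //; lia.
Qed.

(* The coordinates of [u, e_1] are those of u shifted along the chains        *)
(* e_1 -> e_n and e_2 -> ... -> e_(n-1).                                      *)
Lemma co_lb_gen u i : u \in N -> (1 <= i <= n)%N ->
  co e i [lb u, e 1%N] =
    if i == n then co e 1 u else if (3 <= i)%N then co e i.-1 u else 0.
Proof.
move=> uN hi; rewrite {1}(co_expand uN) lb_suml linear_sum /=.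
pose k := if i == n then 1%N else if (3 <= i)%N then i.-1 else 0%N.
rewrite (@eq_big_nat _ _ _ _ _ _ (fun j => if j == k then co e k u else 0)).
  rewrite -big_mkcond big_nat1_eq /k; case: (i =P n) => [_|ni]; first by rewrite ifT //; lia.
  by case: (leqP 3 i) => h3; first by rewrite ifT //; lia.
move=> j hj; rewrite lbZl linearZ /=.
have [j1|j1] := eqVneq j 1%N.
  rewrite j1 frame_lb1 co_frame; try lia.
  rewrite /k; case: (i =P n) => [_|ni] /=; rewrite ?mulr1 ?mulr0 //.
  by rewrite ifN //; case: (leqP 3 i) => ?; lia.
have [j2|j2] := leqP j (n - 2).
  rewrite frame_lbS ?co_frame; try lia.
  have [ij|ij] := eqVneq i j.+1; rewrite ?mulr1 ?mulr0.
    have -> : k = j by rewrite /k ifN ?ifT; lia.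
    by rewrite eqxx.
  rewrite ifN // /k.
  by case: (i =P n) => [?|?] //; case: (leqP 3 i) => ?; lia.
rewrite frame_lb0 ?linear0 ?mulr0; try lia.
by rewrite ifN // /k; case: (i =P n) => ?; [|case: (leqP 3 i) => ?]; lia.
Qed.

End Coordinates.
Section CoLb.
Variable e : nat -> L.
Hypothesis fr : M10_frame e.

Lemma co_lb_lt3 u i : u \in N -> (1 <= i <= 2)%N -> co e i [lb u, e 1%N] = 0.
Proof. by move=> uN hi; rewrite (co_lb_gen fr) ?ifN //; lia. Qed.

Lemma co_lbS u i : u \in N -> (2 <= i <= n - 2)%N ->
  co e i.+1 [lb u, e 1%N] = co e i u.
Proof.
move=> uN hi; rewrite (co_lb_gen fr) //; last by lia.
by rewrite ifN ?ifT //; lia.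
Qed.

Lemma co_lbn u : u \in N -> co e n [lb u, e 1%N] = co e 1 u.
Proof. by move=> uN; rewrite (co_lb_gen fr) ?eqxx //; lia. Qed.

End CoLb.

(** Guaranteed for ideals of codimension one by [ideal_absorbs]. *)
Hypothesis N_absorbs : forall u v, [lb u, v] \in N.

(** * Right multiplication by x as a derivation of N *)

Section RightMultiplication.
Variables (e : nat -> L) (x : L).
Hypothesis fr : M10_frame e.
Local Notation a1 := (co e 1 [lb e 1%N, x]).
Local Notation b := (co e 2 [lb e 2%N, x]).

(** Differentiating [e_1, e_2] = 0 along x leaves only [e_1, [e_2, x]], which is this coordinate
    times e_n. *)
Lemma co1_e2x : co e 1 [lb e 2%N, x] = 0.
Proof.
have eN i : (1 <= i <= n)%N -> e i \in N by exact: frame_mem.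
have e12 : [lb e 1%N, e 2%N] = 0.
  by rewrite (frame_lbE fr) ?eN ?(co_frame fr) ?scale0r //; lia.
have := lb_derivation (e 1%N) (e 2%N) x.
rewrite e12 lb0l (frame_lbE fr (N_absorbs _ _) (eN _ _)) ?(co_frame fr) ?scale0r ?add0r //; try lia.
rewrite (frame_lbE fr (eN _ _)) ?frame_lb1 //; try lia.
move/(congr1 (co e n)); rewrite linear0 linearZ /= (co_frame fr) //; try lia.
by rewrite eqxx mulr1.
Qed.

Lemma lb_enx_rec : [lb e n, x] = [lb [lb e 1%N, x], e 1%N] + a1 *: e n.
Proof.
rewrite -{1}(frame_lb1 fr) lb_derivation; congr (_ + _).
by rewrite (frame_lbE fr) ?frame_lb1 // (frame_mem fr); lia.
Qed.

Lemma lb_eSx i : (2 <= i <= n - 2)%N ->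
  [lb e i.+1, x] = [lb [lb e i, x], e 1%N] + a1 *: e i.+1.
Proof.
move=> hi; rewrite -{1}(frame_lbS fr hi) lb_derivation; congr (_ + _).
by rewrite (frame_lbE fr) ?frame_lbS // (frame_mem fr); lia.
Qed.

(** Differentiating [e_n, e_1] = 0 along x gives [[[e_1, x], e_1], e_1] = 0, and two shifts along
    e_2 -> ... -> e_(n-1) lose nothing of the coordinates 2, ..., n - 3. *)
Lemma co_e1x i : (2 <= i <= n - 3)%N -> co e i [lb e 1%N, x] = 0.
Proof.
move=> hi.
have en1 : [lb e n, e 1%N] = 0 by rewrite (frame_lb0 fr) //; lia.
have := lb_derivation (e n) (e 1%N) x.
rewrite en1 lb0l [X in _ + X](frame_lbE fr) ?(frame_mem fr) //; try lia.
rewrite en1 scaler0 addr0 lb_enx_rec lbDl lbZl en1 scaler0 addr0.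
move/(congr1 (co e i.+2)); rewrite linear0.
by rewrite (co_lbS fr (N_absorbs _ _)) ?(co_lbS fr (N_absorbs _ _)) //; lia.
Qed.

Lemma lb_e1x : [lb e 1%N, x] = a1 *: e 1%N + co e (n - 2) [lb e 1%N, x] *: e (n - 2)%N
  + co e (n - 1) [lb e 1%N, x] *: e (n - 1)%N + co e n [lb e 1%N, x] *: e n.
Proof.
rewrite [LHS](@co_support _ fr [:: 1; n - 2; n - 1; n]%N) //.
- by rewrite !big_cons big_nil addr0 !addrA.
- by rewrite /= !inE; lia.
- by move=> i; rewrite !inE; lia.
- by move=> i hi; rewrite !inE => hS; rewrite co_e1x //; lia.
Qed.

Lemma lb_enx : [lb e n, x] = (2 * a1) *: e n + co e (n - 2) [lb e 1%N, x] *: e (n - 1)%N.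
Proof.
have e1e1 := frame_lb1 fr; have en2e1 : [lb e (n - 2)%N, e 1%N] = e (n - 1)%N.
  by rewrite (frame_lbS fr); [congr e; lia | lia].
have en1e1 : [lb e (n - 1)%N, e 1%N] = 0 by rewrite (frame_lb0 fr) //; lia.
have ene1 : [lb e n, e 1%N] = 0 by rewrite (frame_lb0 fr) //; lia.
rewrite lb_enx_rec {1}lb_e1x !lbE e1e1 en2e1 en1e1 ene1; vring.
Qed.

(** Differentiating e_(i+1) = [e_i, e_1] shifts the row of e_i by one place and adds [a1] on the
    diagonal. So the row of e_2 determines the later ones, and e_i has diagonal entry b + (i - 2)
    a_1. *)
Lemma co_eix i t : (2 <= i <= n - 1)%N -> (1 <= t <= n - 1)%N ->
  co e t [lb e i, x] =
    (if (i <= t)%N then co e (t - i + 2) [lb e 2%N, x] else 0)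
    + (i == t)%:R * (i%:R - 2) * a1.
Proof.
elim: i t => // i IH t hi ht; have [i1|i1] := eqVneq i 1%N.
  rewrite i1 subrr mulr0 mul0r addr0; case: ifP => h2.
    by congr (co e _ _); lia.
  by rewrite (_ : t = 1)%N ?co1_e2x //; lia.
rewrite lb_eSx ?linearD ?linearZ /=; try lia.
rewrite (co_frame fr) //; try lia.
have [t2|t2] := leqP t 2.
  rewrite (co_lb_lt3 fr) //; try lia.
  have it : (i.+1 == t) = false by lia.
  by rewrite ifN ?[t == _]eq_sym ?it /=; [ring | lia].
case: t ht t2 => // t ht t2.
rewrite (co_lbS fr) ?IH //; try lia.
rewrite subSS !ltnS !eqSS eq_sym -(natr1 i); ring.
Qed.

(** An e_n coordinate of [[e_i, x], e_1] could only come from an e_1 coordinate of [e_i, x], which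
    is zero for i >= 2. *)
Lemma con_eix i : (3 <= i <= n - 1)%N -> co e n [lb e i, x] = 0.
Proof.
case: i => // i hi; rewrite lb_eSx ?linearD ?linearZ /=; try lia.
rewrite (co_lbn fr) // (co_frame fr); try lia.
have nSi : (n == i.+1) = false by lia.
rewrite nSi mulr0 addr0.
have [->|i2] := eqVneq i 2%N; first exact: co1_e2x.
rewrite co_eix; try lia.
have i1 : (i == 1)%N = false by lia.
by rewrite ifN ?i1 ?mul0r ?addr0 //; lia.
Qed.

Lemma lb_en1x : [lb e (n - 1)%N, x] = (b + (n%:R - 3) * a1) *: e (n - 1)%N.
Proof.
rewrite [LHS](@co_support _ fr [:: n - 1]%N) ?big_seq1 //.
- rewrite co_eix ?leqnn ?eqxx ?subnn; try lia.
  by rewrite natrB /= ?add0n; [congr (_ *: _); ring | lia].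
- by move=> i; rewrite !inE; lia.
move=> i hi; rewrite !inE => hS; have [->|ni] := eqVneq i n.
  by rewrite con_eix //; lia.
rewrite co_eix; try lia; rewrite ifN ?[_ == i]eq_sym ?(negPf hS) ?mul0r ?addr0 //; lia.
Qed.

(** On the span of e_3, ..., e_(n-1) the map v -> [v, x] - b v is triangular with diagonal entries
    (k - 2) a_1. These are nonzero in characteristic 0, so the map is invertible there. *)
Lemma co_derivation_solve w : a1 != 0 -> w \in N ->
    co e 1 w = 0 -> co e 2 w = 0 -> co e n w = 0 ->
  exists v, [/\ v \in N, co e 1 v = 0, co e 2 v = 0, co e n v = 0
    & [lb v, x] - b *: v = w].
Proof.
move=> a1N0.
(* Elimination from the lowest coordinate up: those of [w'] below [k] already vanish, and [m] is the
   induction measure. *)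
suff solve m k w' : (n - k <= m)%N -> (3 <= k)%N -> w' \in N -> co e n w' = 0 ->
    (forall i, (1 <= i < k)%N -> (i < n)%N -> co e i w' = 0) ->
  exists v, [/\ v \in N, co e 1 v = 0, co e 2 v = 0, co e n v = 0
    & [lb v, x] - b *: v = w'].
  move=> wN w1 w2 wn; apply: (solve n 3%N) => // [|i hi _]; first by lia.
  by have [->|->] : i = 1%N \/ i = 2%N by lia.
elim: m k w' => [|m IH] k w' hk k3 w'N w'n w'k.
  exists 0; rewrite !linear0 mem0v lb0l addr0; split => //.
  apply/esym/(co_inj fr) => //; first exact: mem0v.
  move=> i hi; rewrite linear0; have [->//|?] := eqVneq i n; apply: w'k; lia.
have [kn|kn] := leqP n k.
  by apply: (IH k.+1) => //; [lia | lia | move=> i hi ?; apply: w'k; lia].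
pose c := co e k w' / ((k%:R - 2) * a1).
have ekN : e k \in N by apply: (frame_mem fr); lia.
have muN0 : (k%:R - 2) * a1 != 0.
  by rewrite mulf_neq0 // subr_eq0 (eqr_nat K k 2); lia.
have [|||||v [vN v1 v2 vn vE]] := IH k.+1 (w' - (c *: [lb e k, x] - b *: (c *: e k))).
- by lia.
- by lia.
- by rewrite !(rpredB, memvZ).
- rewrite !linearB !linearZ /= con_eix ?(co_frame fr) ?w'n; try lia.
  have nk : (n == k) = false by lia.
  by rewrite nk !mulr0 !subrr.
- move=> i hi iltn; rewrite !linearB !linearZ /= co_eix ?(co_frame fr) //; try lia.
  have [->|ik] := eqVneq i k.
    rewrite leqnn ?eqxx subnn /= add0n /c; move: muN0; rewrite mulf_eq0 negb_or => /andP[? ?].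
    by field; apply/andP.
  have ki : (i < k)%N by lia.
  by rewrite leqNgt ki w'k /=; [ring | lia | lia].
exists (c *: e k + v); split.
- by rewrite memvD ?memvZ.
- rewrite linearD linearZ /= v1 (co_frame fr) //; try lia.
  have ek : (1 == k)%N = false by lia.
  by rewrite ek mulr0 addr0.
- rewrite linearD linearZ /= v2 (co_frame fr) //; try lia.
  have ek : (2 == k)%N = false by lia.
  by rewrite ek mulr0 addr0.
- rewrite linearD linearZ /= vn (co_frame fr) //; try lia.
  have ek : (n == k)%N = false by lia.
  by rewrite ek mulr0 addr0.
- move/(congr1 (+%R^~ (c *: [lb e k, x] - b *: (c *: e k)))): vE; rewrite subrK => <-.
  by rewrite !lbE; vring.
Qed.

End RightMultiplication.

(** * Left multiplication by x *)

Section LeftMultiplication.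
Variables (e : nat -> L) (x : L).
Hypothesis fr : M10_frame e.
Local Notation a1 := (co e 1 [lb e 1%N, x]).
Local Notation b := (co e 2 [lb e 2%N, x]).

(** Used to read off that elements of N in the right annihilator have no e_1 coordinate. *)
Lemma lb_e1_eq0 u : u \in N -> [lb e 1%N, u] = 0 -> co e 1 u = 0.
Proof.
move=> uN; rewrite (frame_lbE fr (frame_mem fr _)) ?(frame_lb1 fr) //; last by lia.
move/(congr1 (co e n)); rewrite linear0 linearZ /= (co_frame fr) ?eqxx ?mulr1 //; lia.
Qed.

Lemma co1_xe1 : co e 1 [lb x, e 1%N] = - a1.
Proof.
apply/eqP; rewrite -addr_eq0 -linearD; apply/eqP/lb_e1_eq0.
  by rewrite memvD.
exact: lb_symr0.
Qed.

Lemma co1_xx : co e 1 [lb x, x] = 0.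
Proof. exact: lb_e1_eq0 (N_absorbs _ _) (lb_sqr0 _ _). Qed.

(** Each of these e_j is the square [e_1, e_1] or a symmetrised bracket of e_(j-1) and e_1, hence
    lies in the right annihilator. *)
Lemma lb_xej_ge3 j : (3 <= j <= n)%N -> [lb x, e j] = 0.
Proof.
move=> hj; have [->|jn] := eqVneq j n; first by rewrite -(frame_lb1 fr) lb_sqr0.
have -> : e j = [lb e j.-1, e 1%N] + [lb e 1%N, e j.-1].
  rewrite (frame_lbS fr) ?prednK; try lia.
  rewrite (frame_lbE fr) ?(frame_mem fr) ?(co_frame fr); try lia.
  have -> : (1 == j.-1)%N = false by lia.
  by rewrite scale0r addr0.
exact: lb_symr0.
Qed.

Lemma lb_xu u : u \in N -> co e 1 u = 0 -> [lb x, u] = co e 2 u *: [lb x, e 2%N].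
Proof.
move=> uN u1; rewrite {1}(co_expand fr uN) lb_sumr.
rewrite (big_cat_nat _ (n := 3)) //=; last by lia.
rewrite [X in _ + X]big_nat_cond [X in _ + X]big1 ?addr0; last first.
  by move=> i hi; rewrite lbZr lb_xej_ge3 ?scaler0 //; lia.
by rewrite big_nat_recl // big_nat1 u1 scale0r lb0r add0r lbZr.
Qed.

(** Let w = [x, e_2]. The Leibniz identity for (x, e_2, e_1) gives [w, e_1] = 0, so w lies in
    <e_(n-1), e_n> and [x, w] = 0. Then b w = [x, [e_2, x]] = -[x, w] = 0, which settles nonzero b.
    If b = 0, the triple (x, e_2, x) gives [w, x] = 0, while x acts on <e_(n-1), e_n> with the
    nonzero eigenvalues (n - 3) a_1 and 2 a_1. *)
Lemma lb_xe2 : (a1 != 0) || (b != 0) -> [lb x, e 2%N] = 0.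
Proof.
set w := [lb x, e 2%N] => a1b.
have wN : w \in N by exact: N_absorbs.
have eN i : (1 <= i <= n)%N -> e i \in N by exact: frame_mem.
have e2x1 := co1_e2x x fr.
have w1 : co e 1 w = 0.
  have := lb_e1_eq0 _ (lb_symr0 (e 1%N) x (e 2%N)).
  by rewrite linearD /= e2x1 addr0; apply; rewrite memvD.
have wE1 : [lb w, e 1%N] = 0.
  have := lbr_leibniz x (e 2%N) (e 1%N); rewrite (frame_lbS fr) ?(@lb_xej_ge3 3); try lia.
  rewrite [X in _ - X](frame_lbE fr) ?eN //; try lia.
  have co12 : co e 1 (e 2%N) = 0 by rewrite (co_frame fr) //; lia.
  by rewrite co12 scale0r subr0 => <-.
have w_lt i : (2 <= i <= n - 2)%N -> co e i w = 0.
  by move=> hi; rewrite -(co_lbS fr wN) // wE1 linear0.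
have xw : [lb x, w] = 0 by rewrite lb_xu // w_lt ?scale0r //; lia.
have bw : b *: w = 0.
  rewrite /w -(lb_xu (N_absorbs _ _) e2x1).
  by have := lb_symr0 x (e 2%N) x; rewrite lbDr -/w xw addr0.
have [b0|bN0] := eqVneq b 0; last by apply/eqP; move/eqP: bw; rewrite scaler_eq0 (negPf bN0).
move: a1b; rewrite b0 eqxx orbF => a1N0.
have wE : w = co e (n - 1) w *: e (n - 1)%N + co e n w *: e n.
  rewrite [LHS](co_support fr (S := [:: n - 1; n]%N)) //.
  - by rewrite !big_cons big_nil addr0.
  - by rewrite /= !inE; lia.
  - by move=> i; rewrite !inE; lia.
  - move=> i hi; rewrite !inE => hS; have [->//|?] := eqVneq i 1%N.
    by rewrite w_lt //; lia.
have wx : [lb w, x] = 0.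
  have := lbr_leibniz x (e 2%N) x.
  rewrite (lb_xu (N_absorbs _ _) e2x1) bw [X in _ - X](frame_lbE fr) ?eN ?(co_frame fr) //; try lia.
  by rewrite scale0r subr0.
move: wx; rewrite wE !lbE (lb_en1x x fr) (lb_enx x fr) b0 add0r => wx.
have n1 : (n == n - 1)%N = false by lia.
have n2 : (n - 1 == n)%N = false by lia.
have wn : co e n w = 0.
  move/(congr1 (co e n)): wx; rewrite !(linearD, linearZ) /= !(co_frame fr); try lia.
  rewrite n1 eqxx linear0 => /eqP.
  rewrite !mulr0 add0r addr0 mulr1 !mulf_eq0 (negPf a1N0) orbF.
  by rewrite (pnatr_eq0 K 2) orbF => /eqP.
have wn1 : co e (n - 1) w = 0.
  move/(congr1 (co e (n - 1))): wx; rewrite wn scale0r addr0 !linearZ /= !(co_frame fr); try lia.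
  rewrite eqxx linear0 mulr1 => /eqP; rewrite !mulf_eq0 (negPf a1N0) orbF.
  by rewrite subr_eq0 (eqr_nat K n 3) => /orP[/eqP//|?]; lia.
by rewrite wn wn1 !scale0r addr0.
Qed.

(* This is the Leibniz identity for the triple (x, e_1, x).                   *)
Lemma lb_xe1_constraint :
  [lb [lb x, e 1%N], x] - a1 *: [lb x, e 1%N] = [lb [lb x, x], e 1%N].
Proof.
have := lbr_leibniz x (e 1%N) x.
rewrite {1}(lb_e1x x fr) !lbDr !lbZr (@lb_xej_ge3 (n - 2)) ?(@lb_xej_ge3 (n - 1)) ?(@lb_xej_ge3 n); try lia.
rewrite !scaler0 !addr0.
by move=> ->; rewrite opprB addrC subrK.
Qed.

End LeftMultiplication.
(* Position of e_t in the ordering e_1, ..., e_(n-2), e_n, e_(n-1), in which  *)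
(* right multiplications are triangular.                                      *)
Definition pos (t : nat) : nat :=
  if t == n.-1 then n else if t == n then n.-1 else t.

Lemma pos_cases t : t = n.-1 /\ pos t = n \/ t = n /\ pos t = n.-1 \/
  t <> n.-1 /\ t <> n /\ pos t = t.
Proof. by rewrite /pos; case: (t =P n.-1) => ?; [|case: (t =P n) => ?]; lia.
Qed.

Lemma posK t : pos (pos t) = t.
Proof.
rewrite /pos; case: (t =P n.-1) => [->|t1].
  by rewrite eqxx ifN //; lia.
case: (t =P n) => [->|t2]; first by rewrite eqxx.
by rewrite !ifN //; lia.
Qed.

Lemma pos_range t : (1 <= t <= n)%N -> (1 <= pos t <= n)%N.
Proof. by have := pos_cases t; lia. Qed.

(** In a frame, the span of the e_t at positions k and beyond. Kernels of coordinate forms make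
    membership a condition on coordinates, see [flagP]. *)
Definition flag e (k : nat) : {vspace L} :=
  (N :&: \bigcap_(t <- iota 1 n | (pos t < k)%N) lker (linfun (co e t : L -> K^o)))%VS.

Lemma flagP e k u : reflect
  (u \in N /\ forall t, (1 <= t <= n)%N -> (pos t < k)%N -> co e t u = 0)
  (u \in flag e k).
Proof.
rewrite memv_cap; apply: (iffP andP) => -[uN uk]; split => //.
  move=> t ht tk; move: uk; rewrite (big_rem t) /= ?mem_iota; last by lia.
  by rewrite tk memv_cap memv_ker lfunE /= => /andP[/eqP].
rewrite big_seq_cond; elim/big_ind: _ => [|U V uU uV|t]; first exact: memvf.
  by rewrite memv_cap uU.
rewrite mem_iota => /andP[ht tk]; rewrite memv_ker lfunE /= uk //; lia.
Qed.

(** * Flags, and why some weight is nonzero *)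

Section Flags.
Variable e : nat -> L.
Hypothesis fr : M10_frame e.

Lemma flag_last k u : (n < k)%N -> u \in flag e k -> u = 0.
Proof.
move=> nk /flagP[uN uk]; apply: (co_inj fr uN (mem0v _)) => t ht.
by rewrite linear0 uk //; have := pos_range ht; lia.
Qed.

Lemma flag_lb_e1 k u : (1 <= k)%N -> u \in flag e k -> [lb u, e 1%N] \in flag e k.+1.
Proof.
move=> k1 /flagP[uN uk]; apply/flagP; split=> // t ht.
rewrite (co_lb_gen fr) // => tk; case: (t =P n) => tn.
  by apply: uk; have := conj (pos_cases 1) (pos_cases t); lia.
case: ifP => t3 //; apply: uk; first by lia.
by have := conj (pos_cases t.-1) (pos_cases t); lia.
Qed.

(** The change from e to e' is unitriangular along the flag. Clearing one position at a time shows
    that e' spans N, and it has the right number of vectors. *)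
Lemma flag_basis e' :
    (forall i, (1 <= i <= n)%N -> e' i - e i \in flag e (pos i).+1) ->
  basis_of N [seq e' i | i <- iota 1 n].
Proof.
move=> e'P; rewrite basisEdim.
rewrite (size_basis (frame_basis fr)).
rewrite ?size_map ?size_iota leqnn andbT.
suff span m k u : (n.+1 - k <= m)%N -> (1 <= k)%N -> u \in flag e k ->
    u \in <<[seq e' i | i <- iota 1 n]>>%VS.
  apply/subvP => u uN; apply: (@span n 1%N); rewrite ?subn1 //.
  apply/flagP; split=> // t ht; have := pos_range ht; lia.
elim: m k u => [|m IH] k u mk k1 uk.
  by rewrite (flag_last _ uk) ?mem0v //; lia.
have [nk|kn] := ltnP n k; first by rewrite (flag_last nk uk) mem0v.
have hpk : (1 <= pos k <= n)%N by apply: pos_range; lia.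
rewrite -(subrK (co e (pos k) u *: e' (pos k)) u) memvD ?memvZ //; last first.
  by apply: memv_span; apply: map_f; rewrite mem_iota; lia.
apply: (IH k.+1) => //; first by lia.
have [uN uk'] := flagP _ _ _ uk.
have /flagP[dN dk] := e'P _ hpk; rewrite posK in dk.
have eN := frame_mem fr hpk.
apply/flagP; rewrite -(subrK (e (pos k)) (e' (pos k))); split=> [|t ht tk].
  by rewrite memvB ?memvZ 1?memvD.
rewrite linearB linearZ linearD /= dk // add0r (co_frame fr) //.
have [tpk|tpk] := eqVneq t (pos k); first by rewrite tpk mulr1 subrr.
rewrite mulr0 subr0 uk' // ltn_neqAle -ltnS tk andbT.
by apply: contraNneq tpk => <-; rewrite posK.
Qed.

End Flags.

(** If both weights vanish, right multiplication by x, like that by e_1, pushes each step of the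
    flag into the next. The lower central series of L then reaches 0, so L is a nilpotent ideal
    containing N, and maximality forces N = L, against the choice of x. *)
Lemma nonnilpotent_ext e x : M10_frame e -> leibniz_nilradical N ->
    x \notin N -> (forall v, exists c, v - c *: x \in N) ->
  (co e 1 [lb e 1%N, x] != 0) || (co e 2 [lb e 2%N, x] != 0).
Proof.
move=> fr [_ _ maxN] xN Lx; rewrite -negb_and; apply/negP => /andP[/eqP a0 /eqP b0].
have co_tri i t : (1 <= i <= n)%N -> (1 <= t <= n)%N -> (pos t <= pos i)%N ->
    co e t [lb e i, x] = 0.
  move=> hi ht hti; have [i1|i1] := eqVneq i 1%N.
    suff -> : t = 1%N by rewrite i1.
    by have := conj (pos_cases i) (pos_cases t); lia.
  have [iN|iN] := eqVneq i n.
    have t1 : (t == n - 1)%N = false.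
      by have := conj (pos_cases i) (pos_cases t); lia.
    rewrite iN (lb_enx x fr) a0 mulr0 scale0r add0r linearZ /= (co_frame fr) ?t1 ?mulr0 //; lia.
  have [iN1|iN1] := eqVneq i (n - 1)%N.
    by rewrite iN1 (lb_en1x x fr) a0 b0 mulr0 addr0 scale0r linear0.
  have ti : (t <= i)%N.
    by have := conj (pos_cases i) (pos_cases t); lia.
  rewrite (co_eix x fr) ?a0 ?mulr0 ?addr0; try lia.
  by case: ifP => // it; rewrite (_ : t - i + 2 = 2)%N ?b0 //; lia.
have flag_x k u : u \in flag e k -> [lb u, x] \in flag e k.+1.
  move=> /flagP[uN uk]; apply/flagP; split=> // t ht tk.
  rewrite (co_expand fr uN) lb_suml linear_sum big_nat_cond big1 // => i /andP[hi _].
  rewrite lbZl linearZ /=; have [ik|ki] := ltnP (pos i) k.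
    by rewrite uk ?mul0r //; lia.
  by rewrite co_tri ?mulr0 //; lia.
have lcs k : (lower_central_series {:L} k.+1 <= flag e k.+1)%VS.
  elim: k => [|k IH].
    apply/lbrv_subvP => u v _ _; apply/flagP; split=> // t ht.
    by have := pos_range ht; lia.
  apply/lbrv_subvP => u v /(subvP IH) uk _; have [c vN] := Lx v.
  have [uN _] := flagP _ _ _ uk.
  rewrite -(subrK (c *: x) v) lbDr lbZr memvD ?memvZ ?flag_x //.
  by rewrite (frame_lbE fr) // memvZ // flag_lb_e1.
have fullN : leibniz_nilpotent {:L}.
  exists n.+1; apply/eqP; rewrite -subv0; apply/subvP => u /(subvP (lcs n)) uk.
  by rewrite (flag_last fr _ uk) ?mem0v.
have LN := maxN fullv (fun u v _ => conj (memvf _) (memvf _)) fullN (subvf _).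
by rewrite -LN memvf in xN.
Qed.

(** * Changes of frame *)

Section FrameChange.
Variables (e : nat -> L) (u v : L).
Hypotheses (fr : M10_frame e) (uN : u \in N) (vN : v \in N).
Hypotheses (u1 : co e 1 u = 0) (u_lt : forall i, (2 <= i <= n - 3)%N -> co e i u = 0).
Hypotheses (v1 : co e 1 v = 0) (v2 : co e 2 v = 0).

Lemma iter_lb_mem j : iter j (rlbr (e 1%N)) v \in N.
Proof. by case: j => //= j; exact: N_absorbs. Qed.

Lemma co1_iter_lb j : co e 1 (iter j (rlbr (e 1%N)) v) = 0.
Proof. by case: j => //= j; rewrite (co_lb_lt3 fr) ?iter_lb_mem. Qed.

Lemma con_iter_lb j : (0 < j)%N -> co e n (iter j (rlbr (e 1%N)) v) = 0.
Proof. by case: j => //= j _; rewrite (co_lbn fr) ?iter_lb_mem ?co1_iter_lb. Qed.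

Lemma co_iter_lb j t : (1 <= t <= n - 1)%N -> (t <= j.+2)%N ->
  co e t (iter j (rlbr (e 1%N)) v) = 0.
Proof.
elim: j t => [|j IH] t ht tj.
  by have [->|->] : t = 1%N \/ t = 2%N by lia.
rewrite /= (co_lb_gen fr) ?iter_lb_mem //; last by lia.
rewrite ifN; last by lia.
by case: ifP => // t3; apply: IH; lia.
Qed.

Lemma iter_lb_eq0 j : (n - 3 <= j)%N -> iter j (rlbr (e 1%N)) v = 0.
Proof.
move=> hj; apply: (co_inj fr (iter_lb_mem _) (mem0v _)) => t ht; rewrite linear0.
have [->|tn] := eqVneq t n; first by apply: con_iter_lb; lia.
by apply: co_iter_lb; lia.
Qed.

Lemma lb_tail_e1 : [lb u, e 1%N] = co e (n - 2) u *: e (n - 1)%N.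
Proof.
apply: (co_inj fr) => [//||t ht]; first by rewrite memvZ ?(frame_mem fr) //; lia.
rewrite (co_lb_gen fr) // linearZ /= (co_frame fr) //; last by lia.
have [->|tn] := eqVneq t n.
  by rewrite u1 (_ : (n == n - 1)%N = false) ?mulr0 //; lia.
have [tn1|tn1] := eqVneq t (n - 1)%N.
  by rewrite mulr1 ifT; [congr (co e _ _); lia | lia].
by rewrite mulr0; case: ifP => // t3; apply: u_lt; lia.
Qed.

(** The new generators e_1 + u and e_2 + v force the other vectors: e'_n = [e'_1, e'_1] and e'_(i+1)
    = [e'_i, e'_1]. The conditions on u reduce [u, e_1] to a multiple of e_(n-1), whence
    [e'_n, e'_1] = 0; with those on v they make the change unitriangular along the flag. *)
Lemma frame_change : exists e', [/\ M10_frame e', e' 1%N = e 1%N + u,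
    e' n = e n + co e (n - 2) u *: e (n - 1)%N
  & forall i, (2 <= i <= n - 1)%N -> e' i = e i + iter (i - 2) (rlbr (e 1%N)) v].
Proof.
pose e' i := if i == 1%N then e 1%N + u
  else if i == n then e n + co e (n - 2) u *: e (n - 1)%N
  else e i + iter (i - 2) (rlbr (e 1%N)) v.
have e'1 : e' 1%N = e 1%N + u by [].
have e'n : e' n = e n + co e (n - 2) u *: e (n - 1)%N.
  by rewrite /e' eqxx ifN //; lia.
have e'i i : (2 <= i <= n - 1)%N -> e' i = e i + iter (i - 2) (rlbr (e 1%N)) v.
  by move=> hi; rewrite /e' !ifN //; lia.
have eN i : (1 <= i <= n)%N -> e i \in N by exact: frame_mem.
have e'N i : (1 <= i <= n)%N -> e' i \in N.
  move=> hi; rewrite /e'; case: ifP => _; first by rewrite memvD ?eN //; lia.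
  by case: ifP => _; rewrite memvD ?memvZ ?eN ?iter_lb_mem //; lia.
have co1e' i : (1 <= i <= n)%N -> co e 1 (e' i) = (i == 1%N)%:R.
  move=> hi; rewrite /e'; case: ifP => i1.
    by rewrite linearD /= u1 addr0 (co_frame fr) //; lia.
  case: ifP => iN; rewrite linearD ?linearZ /= ?co1_iter_lb !(co_frame fr); try lia.
    have [-> ->] : (1 == n)%N = false /\ (1 == n - 1)%N = false by lia.
    by rewrite mulr0 addr0.
  by rewrite eq_sym i1 addr0.
exists e'; split=> //; split; last first.
  move=> i j hi hj; rewrite (frame_lbE fr) ?e'N // co1e' // /M10_prod.
  case: eqP => _; last by rewrite scale0r.
  rewrite scale1r; have [->|i1] := eqVneq i 1%N.
    by rewrite e'1 e'n lbDl (frame_lb1 fr) lb_tail_e1.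
  have [->|iN] := eqVneq i n.
    rewrite e'n lbDl lbZl !(frame_lb0 fr) ?scaler0 ?addr0; try lia.
    by rewrite ifN //; lia.
  rewrite e'i ?lbDl -?[[lb iter _ _ _, _]]/(iter (i - 2).+1 (rlbr (e 1%N)) v); last by lia.
  case: ifP => hi2; last first.
    by rewrite iter_lb_eq0 ?(frame_lb0 fr) ?addr0 //; lia.
  by rewrite (frame_lbS fr) // e'i ?subSn //; lia.
apply: (flag_basis fr (e' := e')) => i hi; apply/flagP; split; first by rewrite memvB ?e'N ?eN.
move=> t ht; have [->|i1] := eqVneq i 1%N.
  rewrite e'1 addrC addKr => tp; have [->//|t1] := eqVneq t 1%N.
  by apply: u_lt; have := conj (pos_cases 1) (pos_cases t); lia.
have [->|iN] := eqVneq i n.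
  rewrite e'n addrC addKr linearZ /= (co_frame fr) //; last by lia.
  move=> tp.
  have -> : (t == n - 1)%N = false by have := conj (pos_cases n) (pos_cases t); lia.
  by rewrite mulr0.
rewrite e'i; last by lia.
rewrite addrC addKr => tp; have [tn|tn] := eqVneq t n.
  by rewrite tn; apply: con_iter_lb; have := conj (pos_cases i) (pos_cases t); lia.
apply: co_iter_lb; first by lia.
by have := conj (pos_cases i) (pos_cases t); lia.
Qed.

End FrameChange.
(** In either frame, [e'_1, u] is e'_n times the e_1 coordinate of u. *)
Lemma co1_change e e' u : M10_frame e -> M10_frame e' -> co e 1 (e' 1%N) = 1 ->
  u \in N -> co e' 1 u = co e 1 u.
Proof.
move=> fr fr' e1 uN.
have e'N : e' 1%N \in N by apply: (frame_mem fr'); lia.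
have := frame_lbE fr' e'N uN; rewrite (frame_lbE fr e'N uN).
rewrite [X in _ = _ *: X](frame_lbE fr e'N e'N) e1 scale1r.
have -> : [lb e' 1%N, e 1%N] = e' n.
  by rewrite -(frame_lb1 fr') (frame_lbE fr e'N e'N) e1 scale1r.
move/(congr1 (co e' n)); rewrite !linearZ /= !(co_frame fr') ?eqxx ?mulr1 //; lia.
Qed.

(* Here d is a difference of eigenvalues of x and c the coefficient of a      *)
(* basis change turning the structure constant a into a + c d.                *)
Lemma exists_resonant (a d : K) : exists c, (a + c * d) * d = 0.
Proof.
have [->|d0] := eqVneq d 0; first by exists 0; rewrite mulr0.
by exists (- a / d); rewrite divfK // subrr mul0r.
Qed.

Lemma iter_lb_tail e v i : [lb v, e 1%N] = 0 -> (0 < i)%N ->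
  iter i (rlbr (e 1%N)) v = 0.
Proof.
move=> v0; case: i => // i _; rewrite iterSr [rlbr _ v]v0.
by elim: i => //= i ->; rewrite linear0.
Qed.

(** * Normal forms of the right action when e_1 has weight 1 *)

Section NonzeroWeight.
Variables (e : nat -> L) (x : L).
Hypothesis fr : M10_frame e.
Hypothesis a1 : co e 1 [lb e 1%N, x] = 1.

(** Adding to e_2 a solution from [co_derivation_solve] leaves only e_2 and e_n in [e_2, x]. Since
    e_1 kills e_n, differentiating e'_(i+1) = [e'_i, e'_1] turns all later vectors of the chain into
    eigenvectors. *)
Lemma diagonal_frame : let b := co e 2 [lb e 2%N, x] in
  exists e' g, [/\ M10_frame e', co e' 1 [lb e' 1%N, x] = 1,
    [lb e' 2%N, x] = b *: e' 2%N + g *: e' n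
  & forall i, (3 <= i <= n - 1)%N -> [lb e' i, x] = (i%:R - 2 + b) *: e' i].
Proof.
move=> b; pose g := co e n [lb e 2%N, x].
pose w := [lb e 2%N, x] - b *: e 2%N - g *: e n.
have eN i : (1 <= i <= n)%N -> e i \in N by exact: frame_mem.
have wN : w \in N by rewrite !memvB ?memvZ ?eN //; lia.
have cow t : (1 <= t <= n)%N ->
    co e t w = co e t [lb e 2%N, x] - b * (t == 2%N)%:R - g * (t == n)%:R.
  by move=> ht; rewrite !linearB !linearZ /= !(co_frame fr) //; lia.
have [n1 [n2 n2']] : (1 == n)%N = false /\ (2 == n)%N = false /\ (n == 2)%N = false by lia.
have [|||||v [vN v1 v2 vn vE]] := co_derivation_solve fr (x := x) (w := - w).
- by rewrite a1 oner_neq0.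
- by rewrite memvN.
- rewrite linearN /= cow ?(co1_e2x x fr) ?n1 /=; try lia.
  by rewrite !mulr0 !subr0 oppr0.
- by rewrite linearN /= cow ?n2 /= ?mulr1 ?mulr0 ?subrr ?subr0 ?oppr0 //; lia.
- rewrite linearN /= cow ?eqxx ?n2' /=; try lia.
  by rewrite mulr0 mulr1 subr0 subrr oppr0.
have co0 i : co e i 0 = 0 by rewrite linear0.
have [e' [fr' e'1 e'n e'i]] :=
  frame_change fr (mem0v N) vN (co0 1%N) (fun i _ => co0 i) v1 v2.
rewrite co0 scale0r addr0 in e'n; rewrite addr0 in e'1.
have e'2 : e' 2%N = e 2%N + v by rewrite e'i //; lia.
have a1' : co e' 1 [lb e' 1%N, x] = 1.
  rewrite (co1_change fr fr') ?e'1 // (co_frame fr) //; lia.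
have De'2 : [lb e' 2%N, x] = b *: e' 2%N + g *: e' n.
  rewrite e'2 e'n lbDl; have -> : [lb v, x] = b *: v - w by rewrite -vE addrC subrK.
  rewrite /w; vring.
exists e', g; split=> //; elim=> // i IH hi.
rewrite (lb_eSx x fr') ?a1' ?scale1r; last by lia.
have [i2|i2] := eqVneq i 2%N.
  rewrite i2 De'2 !lbE (frame_lb0 fr' (i := n)) ?(frame_lbS fr'); try lia.
  vring.
rewrite IH ?lbZl ?(frame_lbS fr'); try lia.
rewrite -(natr1 i); vring.
Qed.

(** The generator e_1 is corrected along e_(n-2), e_(n-1), e_n and e_2 along e_n. The eigenvalue
    differences are b + n - 5, b + n - 4, 1 and 2 - b, so the e_n term of [e_1, x] always goes and
    the other constants survive only at resonance. *)
Lemma resonant_frame b g : [lb e 2%N, x] = b *: e 2%N + g *: e n ->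
    (forall i, (3 <= i <= n - 1)%N -> [lb e i, x] = (i%:R - 2 + b) *: e i) ->
  exists e' A B g', [/\ M10_frame e',
    [lb e' 1%N, x] = e' 1%N + A *: e' (n - 2)%N + B *: e' (n - 1)%N,
    [lb e' 2%N, x] = b *: e' 2%N + g' *: e' n,
    forall i, (3 <= i <= n - 1)%N -> [lb e' i, x] = (i%:R - 2 + b) *: e' i
  & [/\ A * (b + n%:R - 5) = 0, B * (b + n%:R - 4) = 0 & g' * (b - 2) = 0]].
Proof.
move=> De2 Dei.
set A := co e (n - 2) [lb e 1%N, x]; set B := co e (n - 1) [lb e 1%N, x].
set C := co e n [lb e 1%N, x].
have De1 : [lb e 1%N, x] = e 1%N + A *: e (n - 2)%N + B *: e (n - 1)%N + C *: e n.
  by rewrite {1}(lb_e1x x fr) a1 scale1r.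
have Den : [lb e n, x] = 2 *: e n + A *: e (n - 1)%N.
  by rewrite (lb_enx x fr) a1 mulr1.
have Den1 : [lb e (n - 1)%N, x] = (n%:R - 3 + b) *: e (n - 1)%N.
  by rewrite Dei ?natrB; try lia; congr (_ *: _); ring.
have Den2 : [lb e (n - 2)%N, x] = (n%:R - 4 + b) *: e (n - 2)%N.
  by rewrite Dei ?natrB; try lia; congr (_ *: _); ring.
have [c1 c1P] := exists_resonant A (b + n%:R - 5).
(* Subtracting C e_n from e_1 also contributes - C A to the e_(n-1) coefficient, as [e_n, x]
   contains A e_(n-1). *)
have [c2 c2P] := exists_resonant (B - C * A) (b + n%:R - 4).
have [c cP] := exists_resonant g (2 - b).
set A' := A + _ in c1P; set B' := _ + c2 * _ in c2P; set g' := g + _ in cP.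
have n3 : n%:R - 3 != 0 :> K by rewrite subr_eq0 (eqr_nat K n 3); lia.
(* Cancels the e_(n-1) term of [e'_2, x] caused by e'_n = e_n + c1 e_(n-1) and by the term A e_(n-1)
   of [e_n, x]; n - 3 is the difference of the eigenvalues of e_(n-1) and e_2. *)
pose d := (c1 * g' - c * A) / (n%:R - 3).
pose u := c1 *: e (n - 2)%N + c2 *: e (n - 1)%N - C *: e n.
pose v := d *: e (n - 1)%N + c *: e n.
have eN i : (1 <= i <= n)%N -> e i \in N by exact: frame_mem.
have uN : u \in N by rewrite rpredB ?rpredD ?memvZ ?eN //; lia.
have vN : v \in N by rewrite rpredD ?memvZ ?eN //; lia.
have cou t : (1 <= t <= n)%N -> co e t u =
    c1 * (t == n - 2)%N%:R + c2 * (t == n - 1)%N%:R - C * (t == n)%:R.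
  by move=> ht; rewrite linearB linearD !linearZ /= !(co_frame fr) //; lia.
have cov t : (1 <= t <= n)%N -> co e t v = d * (t == n - 1)%N%:R + c * (t == n)%:R.
  by move=> ht; rewrite linearD !linearZ /= !(co_frame fr) //; lia.
have u0 t : (1 <= t <= n - 3)%N -> co e t u = 0.
  move=> ht; rewrite cou; last by lia.
  have [-> [-> ->]] : (t == n - 2)%N = false /\ (t == n - 1)%N = false /\ (t == n) = false.
    by lia.
  by rewrite !mulr0 subr0 addr0.
have v0 t : (1 <= t <= n - 2)%N -> co e t v = 0.
  move=> ht; rewrite cov; last by lia.
  have [-> ->] : (t == n - 1)%N = false /\ (t == n) = false by lia.
  by rewrite !mulr0 addr0.
have u2 : co e (n - 2) u = c1.
  rewrite cou ?eqxx; last by lia.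
  have [-> ->] : (n - 2 == n - 1)%N = false /\ (n - 2 == n)%N = false by lia.
  by rewrite !mulr0 subr0 addr0 mulr1.
have u1 : co e 1 u = 0 by apply: u0; lia.
have u_lt t : (2 <= t <= n - 3)%N -> co e t u = 0 by move=> ht; apply: u0; lia.
have v1 : co e 1 v = 0 by apply: v0; lia.
have v2 : co e 2 v = 0 by apply: v0; lia.
have [e' [fr' e'1 e'n e'i]] := frame_change fr uN vN u1 u_lt v1 v2.
rewrite u2 in e'n.
have vE : [lb v, e 1%N] = 0.
  by rewrite /v !lbE !(frame_lb0 fr) ?scaler0 ?addr0 //; lia.
have e'2 : e' 2%N = e 2%N + v by rewrite e'i //; lia.
have e'3 i : (3 <= i <= n - 1)%N -> e' i = e i.
  by move=> hi; rewrite e'i ?(iter_lb_tail vE) ?addr0 //; lia.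
exists e', A', B', g'; split=> //.
- rewrite e'1 !e'3; try lia.
  rewrite lbDl De1 /u !lbE Den2 Den1 Den /A' /B'; vring.
- have dE : d * (n%:R - 3) = c1 * g' - c * A by rewrite /d divfK.
  rewrite e'2 e'n lbDl De2 /v !lbE Den1 Den.
  have -> : d *: ((n%:R - 3 + b) *: e (n - 1)%N) =
      (c1 * g' - c * A + d * b) *: e (n - 1)%N.
    by rewrite scalerA mulrDr dE.
  rewrite /g'; vring.
- by move=> i hi; rewrite e'3 // Dei.
split.
- exact: c1P.
- exact: c2P.
by rewrite -opprB mulrN cP oppr0.
Qed.

End NonzeroWeight.

(** * Shifts of x by elements of N *)

(** An element of N without e_1 coordinate annihilates N from the right, so the right action on N is
    unchanged and only [x, e_1] and [x, x] can move. *)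
Lemma ext_shift e x y : M10_frame e -> y \in N -> co e 1 y = 0 -> x \notin N ->
    (forall j, (2 <= j <= n)%N -> [lb x, e j] = 0) ->
  [/\ x - y \notin N, {in N, forall u, [lb u, x - y] = [lb u, x]},
      forall j, (2 <= j <= n)%N -> [lb x - y, e j] = 0
    & [lb x - y, x - y] = [lb x, x] - [lb y, x]].
Proof.
move=> fr yN y1 xN xe.
have lb_uy u : u \in N -> [lb u, y] = 0.
  by move=> uN; rewrite (frame_lbE fr) // y1 scale0r.
split.
- by apply: contra xN => xyN; rewrite -(subrK y x) memvD.
- by move=> u uN; rewrite lbDr lbNr lb_uy // subr0.
- move=> j hj; rewrite lbDl lbNl xe // (frame_lbE fr) ?(frame_mem fr) //; last by lia.
  have j1 : (1 == j)%N = false by lia.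
  by rewrite (co_frame fr) ?j1 ?scale0r ?subr0 //; lia.
rewrite !lbDl !lbDr !lbNl !lbNr (lb_uy y) // (lb_xu x fr yN y1) xe; last by lia.
by rewrite scaler0 !oppr0 !addr0.
Qed.

(* Subtracting a suitable y from x absorbs all coordinates of [x, e_1] other  *)
(* than those along e_1, e_2 and e_n, as right multiplication by e_1 maps     *)
(* <e_2, ..., e_(n-2)> onto <e_3, ..., e_(n-1)>.                              *)
Lemma ext_shift_xe1 e x : M10_frame e ->
  exists y, [/\ y \in N, co e 1 y = 0 &
    [lb x, e 1%N] - [lb y, e 1%N] = - co e 1 [lb e 1%N, x] *: e 1%N
      + co e 2 [lb x, e 1%N] *: e 2%N + co e n [lb x, e 1%N] *: e n].
Proof.
move=> fr; pose f i := if (2 <= i <= n - 2)%N then co e i.+1 [lb x, e 1%N] else 0.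
have [y yN yE] := co_exists fr f.
have y1 : co e 1 y = 0 by rewrite yE //; lia.
exists y; split=> //.
rewrite [LHS](co_support fr (S := [:: 1; 2; n]%N)).
- rewrite !big_cons big_nil addr0 addrA !linearB /=.
  rewrite (co1_xe1 x fr) (co_lb_lt3 fr yN (i := 1)) // (co_lb_lt3 fr yN (i := 2)) // (co_lbn fr yN) y1 !subr0 //.
- by rewrite memvB.
- by rewrite /= !inE; lia.
- by move=> i; rewrite !inE; lia.
move=> [//|i] hi; rewrite !inE => iS; rewrite linearB /= (co_lbS fr yN); last by lia.
by rewrite yE /f ?ifT ?subrr //; lia.
Qed.

Lemma lb_enx_weight1 e x A B : M10_frame e ->
    [lb e 1%N, x] = e 1%N + A *: e (n - 2)%N + B *: e (n - 1)%N ->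
  co e 1 [lb e 1%N, x] = 1 /\ [lb e n, x] = 2 *: e n + A *: e (n - 1)%N.
Proof.
move=> fr De1.
have [n12 [n11 [n22 n21]]] : (1 == n - 2)%N = false /\ (1 == n - 1)%N = false /\
  (n - 2 == n - 1)%N = false /\ (n - 2 == 1)%N = false by lia.
have a1 : co e 1 [lb e 1%N, x] = 1.
  rewrite De1 !linearD !linearZ /= !(co_frame fr); try lia.
  by rewrite n12 n11 !mulr0 !addr0.
have A1 : co e (n - 2) [lb e 1%N, x] = A.
  rewrite De1 !linearD !linearZ /= !(co_frame fr); try lia.
  by rewrite n21 n22 eqxx mulr0 add0r mulr1 addr0.
by rewrite (lb_enx x fr) a1 A1 mulr1.
Qed.

(** A first shift leaves [x, e_1] = - e_1 + c e_2 + c' e_n. For z = [x, x], [lb_xe1_constraint]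
    expresses [z, e_1] through these constants. That bracket has no e_2 or e_n coordinate, so c (b -
    1) = 0 and c g + c' = 0, and it determines z up to e_(n-1) and e_n. *)
Lemma nonzero_weight_ext e x b A B g : M10_frame e -> x \notin N ->
    [lb e 1%N, x] = e 1%N + A *: e (n - 2)%N + B *: e (n - 1)%N ->
    [lb e 2%N, x] = b *: e 2%N + g *: e n ->
    (forall i, (3 <= i <= n - 1)%N -> [lb e i, x] = (i%:R - 2 + b) *: e i) ->
    g * (b - 2) = 0 ->
  exists x' c s, [/\ x' \notin N,
      {in N, forall u, [lb u, x'] = [lb u, x]},
      [lb x', e 1%N] = - e 1%N + c *: e 2%N /\
        (forall j, (2 <= j <= n)%N -> [lb x', e j] = 0),
      [lb x', x'] = s *: e (n - 1)%N - A *: e (n - 3)%N - B *: e (n - 2)%N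
    & c * (b - 1) = 0 /\ s * (b + n%:R - 3) = 0].
Proof.
move=> fr xN De1 De2 Dei gb.
have eN i : (1 <= i <= n)%N -> e i \in N by exact: frame_mem.
have e1N : e 1%N \in N by apply: eN; lia.
have [n11 n1] : (1 == n - 1)%N = false /\ (1 == n)%N = false by lia.
have [a1 Den] := lb_enx_weight1 fr De1.
have Den1 : [lb e (n - 1)%N, x] = (n%:R - 3 + b) *: e (n - 1)%N.
  by rewrite Dei ?natrB; try lia; congr (_ *: _); ring.
have xe j : (2 <= j <= n)%N -> [lb x, e j] = 0.
  move=> hj; have [->|j2] := eqVneq j 2%N.
    by apply: (lb_xe2 fr); rewrite a1 oner_neq0.
  by apply: (lb_xej_ge3 x fr); lia.
have [y [yN y1]] := ext_shift_xe1 x fr.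
set c := co e 2 _; set c' := co e n _; rewrite a1 => x1e1.
have [x1N x1R x1e x1x1] := ext_shift fr yN y1 xN xe.
rewrite -lbNl -lbDl in x1e1.
set x1 := x - y in x1N x1R x1e x1x1 x1e1.
set z := [lb x1, x1].
have zE : [lb z, e 1%N] = - (A *: e (n - 2)%N) - B *: e (n - 1)%N
    + (c * (b - 1)) *: e 2%N + (c * g + c') *: e n + (c' * A) *: e (n - 1)%N.
  rewrite -(lb_xe1_constraint x1 fr) (x1R _ e1N) a1 scale1r x1R ?N_absorbs // x1e1.
  rewrite !lbE De1 De2 Den; vring.
have [e21 [e22 [e2n [en1 en2]]]] : (2 == n - 2)%N = false /\ (2 == n - 1)%N = false /\
  (2 == n)%N = false /\ (n == n - 1)%N = false /\ (n == n - 2)%N = false by lia.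
have n2 : (n == 2)%N = false by lia.
have zN : z \in N by exact: N_absorbs.
have z1 : co e 1 z = 0 by exact: co1_xx.
have cb : c * (b - 1) = 0.
  rewrite -(co_lb_lt3 fr zN (i := 2)) // zE !(linearB, linearD, linearN, linearZ) /=.
  rewrite !(co_frame fr); try lia.
  by rewrite e21 e22 e2n /=; ring.
(* The factors b - 1 and b - 2 differ by 1, so c and g are not both nonzero. *)
have cg : c * g = 0.
  have -> : c * g = g * (c * (b - 1)) - c * (g * (b - 2)) by ring.
  by rewrite cb gb !mulr0 subrr.
have c'0 : c' = 0.
  have := co_lbn fr zN; rewrite z1 zE !(linearB, linearD, linearN, linearZ) /=.
  rewrite !(co_frame fr); try lia.
  by rewrite en1 en2 n2 eqxx cg /= => <-; ring.
rewrite c'0 cg cb mul0r addr0 !scale0r !addr0 in zE.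
rewrite c'0 scale0r addr0 in x1e1.
set s := co e (n - 1) z; set s' := co e n z.
have z_coords : z = s *: e (n - 1)%N - A *: e (n - 3)%N - B *: e (n - 2)%N + s' *: e n.
  have cozi i : (2 <= i <= n - 2)%N ->
      co e i z = - (A * (i == n - 3)%N%:R) - B * (i == n - 2)%N%:R.
    move=> hi; rewrite -(co_lbS fr zN) // zE linearB linearN !linearZ /=.
    rewrite !(co_frame fr); try lia.
    have -> : (i.+1 == n - 2)%N = (i == n - 3)%N by lia.
    by have -> : (i.+1 == n - 1)%N = (i == n - 2)%N by lia.
  rewrite [LHS](co_support fr (S := [:: n - 3; n - 2; n - 1; n]%N)) //.
  - rewrite !big_cons big_nil addr0 (cozi (n - 3)%N) ?(cozi (n - 2)%N) ?eqxx; try lia.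
    have [-> ->] : (n - 3 == n - 2)%N = false /\ (n - 2 == n - 3)%N = false by lia.
    rewrite -/s -/s' /=; vring.
  - by rewrite /= !inE; lia.
  - by move=> i; rewrite !inE; lia.
  - move=> i hi; rewrite !inE => iS; have [->//|i1] := eqVneq i 1%N.
    rewrite cozi; last by lia.
    have [-> ->] : (i == n - 3)%N = false /\ (i == n - 2)%N = false by lia.
    by rewrite !mulr0 subr0 oppr0.
(* Since e_1 kills e_(n-1) and e_n, a second shift along them keeps [x, e_1]. Their eigenvalues are
   b + n - 3 and 2: the e_n term of [x, x] always goes, the e_(n-1) term unless b = 3 - n. *)
pose k2 := s' / 2.
have [k1 k1P] := exists_resonant (s - k2 * A) (b + n%:R - 3).
pose y2 := - k1 *: e (n - 1)%N + k2 *: e n.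
have y2N : y2 \in N by rewrite rpredD ?memvZ ?eN //; lia.
have y21 : co e 1 y2 = 0.
  by rewrite linearD !linearZ /= !(co_frame fr) ?n11 ?n1 ?mulr0 ?addr0 //; lia.
have [x2N x2R x2e x2x2] := ext_shift fr y2N y21 x1N x1e.
exists (x1 - y2), c, (s - k2 * A + k1 * (b + n%:R - 3)); split=> //.
- by move=> u uN; rewrite x2R // x1R.
- split=> //; rewrite lbDl lbNl x1e1 /y2 !lbE !(frame_lb0 fr); try lia.
  by rewrite !scaler0 addr0 subr0 scaleN1r.
have k2E : k2 * 2 = s' by rewrite divfK // (pnatr_eq0 K 2).
rewrite x2x2 -/z z_coords x1R // /y2 !lbE Den Den1 -k2E; vring.
Qed.

(** * The case of weights (0, 1) *)

(** Now e_1 and e_n have weight 0 and e_2, ..., e_(n-1) weight 1, so precisely the terms linking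
    these two groups can be removed. *)
Lemma zero_weight_frame e x : M10_frame e ->
    co e 1 [lb e 1%N, x] = 0 -> co e 2 [lb e 2%N, x] = 1 ->
  exists e' a, [/\ M10_frame e', [lb e' 1%N, x] = a *: e' n,
    co e' 2 [lb e' 2%N, x] = 1 & co e' n [lb e' 2%N, x] = 0].
Proof.
move=> fr a1 b1.
set A := co e (n - 2) [lb e 1%N, x]; set B := co e (n - 1) [lb e 1%N, x].
set C := co e n [lb e 1%N, x]; pose b3 := co e 3 [lb e 2%N, x].
have eN i : (1 <= i <= n)%N -> e i \in N by exact: frame_mem.
have De1 : [lb e 1%N, x] = A *: e (n - 2)%N + B *: e (n - 1)%N + C *: e n.
  by rewrite {1}(lb_e1x x fr) a1 scale0r add0r.
have Den : [lb e n, x] = A *: e (n - 1)%N.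
  by rewrite (lb_enx x fr) a1 mulr0 scale0r add0r.
have Den1 : [lb e (n - 1)%N, x] = e (n - 1)%N.
  by rewrite (lb_en1x x fr) a1 b1 mulr0 addr0 scale1r.
have Den2 : [lb e (n - 2)%N, x] = e (n - 2)%N + b3 *: e (n - 1)%N.
  rewrite [LHS](co_support fr (S := [:: n - 2; n - 1]%N)) //.
  - rewrite !big_cons big_nil addr0.
    have -> : co e (n - 2) [lb e (n - 2)%N, x] = 1.
      rewrite (co_eix x fr) ?a1 ?mulr0 ?addr0; try lia.
      by rewrite leqnn subnn b1.
    have -> : co e (n - 1) [lb e (n - 2)%N, x] = b3.
      rewrite (co_eix x fr) ?a1 ?mulr0 ?addr0; try lia.
      by rewrite ifT; [congr (co e _ _); lia | lia].
    by rewrite scale1r.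
  - by rewrite /= !inE; lia.
  - by move=> i; rewrite !inE; lia.
  - move=> i hi; rewrite !inE => iS; have [->|ni] := eqVneq i n.
      by rewrite (con_eix x fr) //; lia.
    rewrite (co_eix x fr) ?a1 ?mulr0 ?addr0; try lia.
    by rewrite ifN //; lia.
(* [c2] takes into account the term b3 e_(n-1) of [e_(n-2), x] and the new e'_n = e_n - A
   e_(n-1). *)
pose c := co e n [lb e 2%N, x]; pose c2 := - B + A * b3 - C * A.
pose u := - A *: e (n - 2)%N + c2 *: e (n - 1)%N; pose v := c *: e n.
have uN : u \in N by rewrite memvD ?memvZ ?eN //; lia.
have vN : v \in N by rewrite memvZ ?eN //; lia.
have cou t : (1 <= t <= n - 2)%N -> co e t u = - A * (t == n - 2)%N%:R.
  move=> ht; rewrite linearD !linearZ /= !(co_frame fr); try lia.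
  by have -> : (t == n - 1)%N = false; [lia | rewrite mulr0 addr0].
have u_lt t : (1 <= t <= n - 3)%N -> co e t u = 0.
  move=> ht; rewrite cou; last by lia.
  by have -> : (t == n - 2)%N = false; [lia | rewrite mulr0].
have v_lt t : (1 <= t < n)%N -> co e t v = 0.
  move=> ht; rewrite linearZ /= (co_frame fr); try lia.
  by have -> : (t == n)%N = false; [lia | rewrite mulr0].
have u1 : co e 1 u = 0 by apply: u_lt; lia.
have u_lt' t : (2 <= t <= n - 3)%N -> co e t u = 0 by move=> ht; apply: u_lt; lia.
have v1 : co e 1 v = 0 by apply: v_lt; lia.
have v2 : co e 2 v = 0 by apply: v_lt; lia.
have [e' [fr' e'1 e'n e'i]] := frame_change fr uN vN u1 u_lt' v1 v2.
rewrite cou ?eqxx ?mulr1 in e'n; last by lia.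
have vE : [lb v, e 1%N] = 0 by rewrite /v lbZl (frame_lb0 fr) ?scaler0 //; lia.
have e'2 : e' 2%N = e 2%N + v by rewrite e'i //; lia.
have e'3 i : (3 <= i <= n - 1)%N -> e' i = e i.
  by move=> hi; rewrite e'i ?(iter_lb_tail vE) ?addr0 //; lia.
pose w := [lb e 2%N, x] - e 2%N - c *: e n.
have wN : w \in N by rewrite !memvB ?memvZ ?eN //; lia.
have cow i : (1 <= i <= n)%N -> (i <= 2)%N || (i == n) -> co e i w = 0.
  move=> hi i2; rewrite !linearB linearZ /= !(co_frame fr) //; try lia.
  have [->|i1] := eqVneq i 1%N.
    have -> : (1 == n)%N = false by lia.
    by rewrite (co1_e2x x fr) mulr0 /= !subr0.
  have [->|i2'] := eqVneq i 2%N.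
    have -> : (2 == n)%N = false by lia.
    by rewrite b1 mulr0 subr0 subrr.
  have -> : i = n by lia.
  by rewrite eqxx mulr1 subr0 subrr.
have wE : w = \sum_(i <- iota 3 (n - 3)) co e i w *: e' i.
  rewrite [LHS](co_support fr (S := iota 3 (n - 3))) ?iota_uniq //.
  - rewrite !big_seq; apply: eq_bigr => i; rewrite mem_iota => hi.
    by rewrite e'3 //; lia.
  - by move=> i; rewrite mem_iota; lia.
  - by move=> i hi; rewrite mem_iota => iS; rewrite cow //; lia.
have De'2 : [lb e' 2%N, x] = e' 2%N + w + (c * A) *: e' (n - 1)%N.
  by rewrite e'2 e'3 ?lbDl ?lbZl ?Den /w; [vring | lia].
have co'w i : (i == 2%N) || (i == n) -> co e' i w = 0.
  move=> i2; rewrite wE linear_sum big_seq big1 // => j; rewrite mem_iota => hj.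
  rewrite linearZ /= (co_frame fr') //; try lia.
  by have -> : (i == j) = false; [lia | rewrite mulr0].
clearbody w; exists e', C; split=> //.
- rewrite e'1 e'n /u !lbE De1 Den1 Den2 /c2; vring.
- rewrite De'2 !linearD linearZ /= co'w // !(co_frame fr'); try lia.
  have -> : (2 == n - 1)%N = false by lia.
  by rewrite mulr0 !addr0.
- rewrite De'2 !linearD linearZ /= co'w ?eqxx ?orbT // !(co_frame fr'); try lia.
  have [-> ->] : (n == 2)%N = false /\ (n == n - 1)%N = false by lia.
  by rewrite mulr0 !addr0.
Qed.

Lemma zero_weight_ext e x a : M10_frame e -> x \notin N ->
    [lb e 1%N, x] = a *: e n ->
    co e 2 [lb e 2%N, x] = 1 -> co e n [lb e 2%N, x] = 0 ->
  exists x' a' s, [/\ x' \notin N, [lb e 1%N, x'] = a' *: e n,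
    co e 2 [lb e 2%N, x'] = 1 /\ co e n [lb e 2%N, x'] = 0,
    forall j, (1 <= j <= n)%N -> [lb x', e j] = 0 & [lb x', x'] = s *: e n].
Proof.
move=> fr xN De1 b1 bn.
have eN i : (1 <= i <= n)%N -> e i \in N by exact: frame_mem.
have e1N : e 1%N \in N by apply: eN; lia.
have a1 : co e 1 [lb e 1%N, x] = 0.
  rewrite De1 linearZ /= (co_frame fr); try lia.
  by have -> : (1 == n)%N = false; [lia | rewrite mulr0].
have An2 : co e (n - 2) [lb e 1%N, x] = 0.
  rewrite De1 linearZ /= (co_frame fr); try lia.
  by have -> : (n - 2 == n)%N = false; [lia | rewrite mulr0].
have Den : [lb e n, x] = 0.
  by rewrite (lb_enx x fr) a1 An2 mulr0 !scale0r addr0.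
have Den1 : [lb e (n - 1)%N, x] = e (n - 1)%N.
  by rewrite (lb_en1x x fr) a1 b1 mulr0 addr0 scale1r.
have xe j : (2 <= j <= n)%N -> [lb x, e j] = 0.
  move=> hj; have [->|j2] := eqVneq j 2%N.
    by apply: (lb_xe2 fr); rewrite b1 oner_neq0 orbT.
  by apply: (lb_xej_ge3 x fr); lia.
have [y [yN y1]] := ext_shift_xe1 x fr.
set c := co e 2 _; set c' := co e n _; rewrite a1 oppr0 scale0r add0r => x1e1.
have [x1N x1R x1e x1x1] := ext_shift fr yN y1 xN xe.
rewrite -lbNl -lbDl in x1e1.
set x1 := x - y in x1N x1R x1e x1x1 x1e1.
set z := [lb x1, x1].
have zN : z \in N by exact: N_absorbs.
have zE : [lb z, e 1%N] = c *: [lb e 2%N, x].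
  rewrite -(lb_xe1_constraint x1 fr) (x1R _ e1N) a1 scale0r subr0 x1R ?N_absorbs // x1e1.
  by rewrite lbDl !lbZl Den scaler0 addr0.
have c0 : c = 0.
  have := co_lb_lt3 fr zN (i := 2); rewrite zE linearZ /= b1 mulr1; exact.
rewrite c0 scale0r add0r in x1e1; rewrite c0 scale0r in zE.
set s := co e (n - 1) z; set s' := co e n z.
have z_coords : z = s *: e (n - 1)%N + s' *: e n.
  rewrite [LHS](co_support fr (S := [:: n - 1; n]%N)) //.
  - by rewrite !big_cons big_nil addr0.
  - by rewrite /= !inE; lia.
  - by move=> i; rewrite !inE; lia.
  - move=> i hi; rewrite !inE => iS; have [->|i1] := eqVneq i 1%N.
      exact: co1_xx.
    by rewrite -(co_lbS fr zN) ?zE ?linear0 //; lia.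
pose y2 := s *: e (n - 1)%N.
have y2N : y2 \in N by rewrite memvZ ?eN //; lia.
have y21 : co e 1 y2 = 0.
  rewrite linearZ /= (co_frame fr); try lia.
  by have -> : (1 == n - 1)%N = false; [lia | rewrite mulr0].
have [x2N x2R x2e x2x2] := ext_shift fr y2N y21 x1N x1e.
have x2e1 : [lb x1 - y2, e 1%N] = c' *: e n.
  by rewrite lbDl lbNl x1e1 /y2 lbZl (frame_lb0 fr) ?scaler0 ?subr0 //; lia.
set x2 := x1 - y2 in x2N x2R x2e x2x2 x2e1.
have x2x2' : [lb x2, x2] = s' *: e n.
  by rewrite x2x2 -/z z_coords x1R // /y2 lbZl Den1 addrC addKr.
have e2N : e 2%N \in N by apply: eN; lia.
have De1' : [lb e 1%N, x2] = a *: e n by rewrite x2R // x1R.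
have De2' : [lb e 2%N, x2] = [lb e 2%N, x] by rewrite x2R // x1R.
(* What remains, [x, e_1] = c' e_n, equals [c' e_1, e_1]. Unlike the earlier shifts, subtracting c'
   e_1 alters the right action on N: a becomes a - c', and [e_2, x] changes by - c' e_3, away from
   the coordinates 2 and n. *)
clearbody x2; exists (x2 - c' *: e 1%N), (a - c'), (s' - c' * a); split.
- by apply: contra x2N => h; rewrite -(subrK (c' *: e 1%N) x2) memvD // memvZ.
- by rewrite lbDr lbNr lbZr De1' (frame_lb1 fr) scalerBl.
- rewrite !lbDr !lbNr !lbZr De2' !linearB !linearZ /= b1 bn.
  rewrite (co_lb_lt3 fr e2N) // (co_lbn fr e2N) (co_frame fr) //; try lia.
  by rewrite !mulr0 !subr0.
- move=> j hj; rewrite lbDl lbNl lbZl.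
  have [->|j1] := eqVneq j 1%N; first by rewrite x2e1 (frame_lb1 fr) subrr.
  rewrite x2e; last by lia.
  rewrite (frame_lbE fr e1N (eN j hj)) (co_frame fr) //; last by lia.
  by rewrite eq_sym (negPf j1) scale0r scaler0 subr0.
rewrite !lbDl !lbDr !lbNl !lbNr !lbZl !lbZr x2x2' x2e1 De1' (frame_lb1 fr); vring.
Qed.

(** * Matching the tables *)

Lemma ext_basis e x : M10_frame e -> x \notin N -> \dim {:L} = n.+1 ->
  basis_of {:L} (rcons [seq e i | i <- iota 1 n] x).
Proof.
move=> [bas _] xN dimL.
have -> : basis_of {:L} (rcons [seq e i | i <- iota 1 n] x) =
    basis_of {:L} (x :: [seq e i | i <- iota 1 n]).
  by apply: perm_basis; rewrite perm_rcons.
rewrite basisEfree free_cons (span_basis bas) xN (basis_free bas) dimL subvf /=.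
by rewrite size_map size_iota.
Qed.

Lemma R1_table_products e x a s : M10_frame e -> x \notin N -> \dim {:L} = n.+1 ->
    [lb e 1%N, x] = a *: e n ->
    co e 2 [lb e 2%N, x] = 1 -> co e n [lb e 2%N, x] = 0 ->
    (forall j, (1 <= j <= n)%N -> [lb x, e j] = 0) -> [lb x, x] = s *: e n ->
  exists al, basis_with_products n e x (R1_table n e al).
Proof.
move=> fr xN dimL De1 b1 bn xe xx.
have eN i : (1 <= i <= n)%N -> e i \in N by exact: frame_mem.
have a1 : co e 1 [lb e 1%N, x] = 0.
  rewrite De1 linearZ /= (co_frame fr); try lia.
  by have -> : (1 == n)%N = false; [lia | rewrite mulr0].
have An2 : co e (n - 2) [lb e 1%N, x] = 0.
  rewrite De1 linearZ /= (co_frame fr); try lia.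
  by have -> : (n - 2 == n)%N = false; [lia | rewrite mulr0].
(* In the rows e_i the index t - i + 2 only runs from 3 to n - 1, so the slots 2 and n are free for
   the coefficients of [e_1, x] and [x, x]. *)
exists (fun t => if t == 2%N then a else if t == n then s else co e t [lb e 2%N, x]).
split; [exact: ext_basis | by case: fr | | exact: xe |]; last first.
  by rewrite /= eqxx ifN //; lia.
move=> i hi; rewrite /=; have [->|i1] := eqVneq i 1%N; first by rewrite De1.
have [->|iN] := eqVneq i n.
  rewrite ifN ?(lb_enx x fr) ?a1 ?An2 ?mulr0 ?scale0r ?addr0 //; lia.
rewrite ifT; last by lia.
rewrite (eq_big_nat _ _ (F2 := fun t => co e (t - i + 2) [lb e 2%N, x] *: e t)); last first.
  by move=> t ht; rewrite !ifN //; lia.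
rewrite [LHS](co_support fr (S := i :: index_iota i.+1 n)) //.
- rewrite big_cons; congr (_ + _).
    rewrite (co_eix x fr) ?a1 ?mulr0 ?addr0; try lia.
    by rewrite leqnn subnn b1 scale1r.
  apply: eq_big_nat => t ht; rewrite (co_eix x fr) ?a1 ?mulr0 ?addr0; try lia.
  by rewrite ifT //; lia.
- by rewrite /= iota_uniq andbT mem_index_iota; lia.
- by move=> t; rewrite inE mem_index_iota; lia.
- move=> t ht; rewrite inE mem_index_iota => tS; have [->|tn] := eqVneq t n.
    have [->//|i2] := eqVneq i 2%N; by rewrite (con_eix x fr) //; lia.
  rewrite (co_eix x fr) ?a1 ?mulr0 ?addr0; try lia.
  by rewrite ifN //; lia.
Qed.

(** Each vanishing product kills its constant unless b is the root of its factor. Hence b = 1, 2, 5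
    - n, 4 - n, 3 - n leaves only c, g, A, B, s respectively, and any other b leaves none. *)
Lemma R2_7_table_products e x b A B g c s :
    M10_frame e -> x \notin N -> \dim {:L} = n.+1 ->
    [lb e 1%N, x] = e 1%N + A *: e (n - 2)%N + B *: e (n - 1)%N ->
    [lb e 2%N, x] = b *: e 2%N + g *: e n ->
    (forall i, (3 <= i <= n - 1)%N -> [lb e i, x] = (i%:R - 2 + b) *: e i) ->
    [lb x, e 1%N] = - e 1%N + c *: e 2%N ->
    (forall j, (2 <= j <= n)%N -> [lb x, e j] = 0) ->
    [lb x, x] = s *: e (n - 1)%N - A *: e (n - 3)%N - B *: e (n - 2)%N ->
    A * (b + n%:R - 5) = 0 -> B * (b + n%:R - 4) = 0 -> g * (b - 2) = 0 ->
    c * (b - 1) = 0 -> s * (b + n%:R - 3) = 0 ->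
  (exists a, basis_with_products n e x (R2_table n e a)) \/
  (exists a, basis_with_products n e x (R3_table n e a)) \/
  (exists a, basis_with_products n e x (R4_table n e a)) \/
  (exists a, basis_with_products n e x (R5_table n e a)) \/
  (exists a, basis_with_products n e x (R6_table n e a)) \/
  (exists2 a, a \notin [:: 1; 2; 3 - n%:R; 4 - n%:R; 5 - n%:R]
     & basis_with_products n e x (R7_table n e a)).
Proof.
move=> fr xN dimL De1 De2 Dei xe1 xe xx Ab Bb gb cb sb.
have [_ Den] := lb_enx_weight1 fr De1.
have table (t : ext_table L) :
    ext_ex t 1 = e 1%N + A *: e (n - 2)%N + B *: e (n - 1)%N ->
    ext_ex t 2 = b *: e 2%N + g *: e n ->
    (forall i, (3 <= i <= n - 1)%N -> ext_ex t i = (i%:R - 2 + b) *: e i) ->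
    ext_ex t n = 2 *: e n + A *: e (n - 1)%N ->
    ext_xe t 1 = - e 1%N + c *: e 2%N ->
    (forall j, (2 <= j <= n)%N -> ext_xe t j = 0) ->
    ext_xx t = s *: e (n - 1)%N - A *: e (n - 3)%N - B *: e (n - 2)%N ->
    basis_with_products n e x t.
  move=> t1 t2 ti tn x1 xj txx; split; [exact: ext_basis | by case: fr | | |].
  - move=> i hi; have [->|i1] := eqVneq i 1%N; first by rewrite De1.
    have [->|i2] := eqVneq i 2%N; first by rewrite De2.
    have [->|iN] := eqVneq i n; first by rewrite Den.
    by rewrite Dei ?ti //; lia.
  - move=> j hj; have [->|j1] := eqVneq j 1%N; first by rewrite xe1.
    by rewrite xe ?xj //; lia.
  - by rewrite xx.
have factor0 (X d : K) : X * d = 0 -> d != 0 -> X = 0.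
  by move=> /eqP; rewrite mulf_eq0 => /orP[/eqP//|->].
have nk k : (k < 6)%N -> n%:R - k%:R != 0 :> K.
  by move=> hk; rewrite subr_eq0 eqr_nat; lia.
have [n1 n2] : (n == 1)%N = false /\ (n == 2)%N = false by lia.
have n_out : (n <= n - 1)%N = false by lia.
have [b1|b1] := eqVneq b 1.
  left; exists c.
  have A0 : A = 0.
    by apply: factor0 Ab _; rewrite (_ : _ - _ = n%:R - 4%:R) ?nk // b1; ring.
  have B0 : B = 0.
    by apply: factor0 Bb _; rewrite (_ : _ - _ = n%:R - 3%:R) ?nk // b1; ring.
  have g0 : g = 0.
    apply: factor0 gb _; rewrite b1 (_ : 1 - 2 = -1) ?oppr_eq0 ?oner_eq0 //; ring.
  have s0 : s = 0.
    by apply: factor0 sb _; rewrite (_ : _ - _ = n%:R - 2%:R) ?nk // b1; ring.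
  apply: table; rewrite /= ?A0 ?B0 ?g0 ?s0 ?b1 ?n1 ?eqxx ?n_out ?andbF.
  - vring.
  - by rewrite ifT; [vring | lia].
  - by move=> i hi; rewrite ifN ?ifT; [congr (_ *: _); ring | lia | lia].
  - vring.
  - by [].
  - by move=> j hj; rewrite ifN //; lia.
  - vring.
right; have c0 : c = 0 by apply: factor0 cb _; rewrite subr_eq0.
have [b2|b2] := eqVneq b 2.
  left; exists g.
  have A0 : A = 0.
    by apply: factor0 Ab _; rewrite (_ : _ - _ = n%:R - 3%:R) ?nk // b2; ring.
  have B0 : B = 0.
    by apply: factor0 Bb _; rewrite (_ : _ - _ = n%:R - 2%:R) ?nk // b2; ring.
  have s0 : s = 0.
    by apply: factor0 sb _; rewrite (_ : _ - _ = n%:R - 1%:R) ?nk // b2; ring.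
  apply: table; rewrite /= ?A0 ?B0 ?c0 ?s0 ?b2 ?n1 ?n2 ?eqxx ?n_out ?andbF.
  - vring.
  - by [].
  - move=> i hi; have [-> ->] : (i == 1)%N = false /\ (i == 2)%N = false by lia.
    by rewrite ifT; [congr (_ *: _); ring | lia].
  - vring.
  - vring.
  - by move=> j hj; rewrite ifN //; lia.
  - vring.
right; have g0 : g = 0 by apply: factor0 gb _; rewrite subr_eq0.
have [b5|b5] := eqVneq b (5 - n%:R).
  left; exists A.
  have B0 : B = 0.
    by apply: factor0 Bb _; rewrite (_ : _ - _ = 1) ?oner_eq0 // b5; ring.
  have s0 : s = 0.
    by apply: factor0 sb _; rewrite (_ : _ - _ = 2) ?(pnatr_eq0 K 2) // b5; ring.
  apply: table; rewrite /= ?B0 ?c0 ?s0 ?g0 ?b5 ?n1 ?n2 ?eqxx ?n_out ?andbF.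
  - vring.
  - by rewrite ifT; [vring | lia].
  - by move=> i hi; rewrite ifN ?ifT; [congr (_ *: _); ring | lia | lia].
  - vring.
  - vring.
  - by move=> j hj; rewrite ifN //; lia.
  - vring.
right; have A0 : A = 0.
  by apply: factor0 Ab _; rewrite (_ : _ - _ = b - (5 - n%:R)) ?subr_eq0 //; ring.
have [b4|b4] := eqVneq b (4 - n%:R).
  left; exists B.
  have s0 : s = 0.
    by apply: factor0 sb _; rewrite (_ : _ - _ = 1) ?oner_eq0 // b4; ring.
  apply: table; rewrite /= ?A0 ?c0 ?s0 ?g0 ?b4 ?n1 ?n2 ?eqxx ?leqnn ?n_out.
  - vring.
  - by rewrite ifT; [vring | lia].
  - by move=> i hi; rewrite ifN ?ifT; [congr (_ *: _); ring | lia | lia].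
  - by rewrite ifT; [vring | lia].
  - vring.
  - by move=> j hj; rewrite ifN //; lia.
  - vring.
right; have B0 : B = 0.
  by apply: factor0 Bb _; rewrite (_ : _ - _ = b - (4 - n%:R)) ?subr_eq0 //; ring.
have [b3|b3] := eqVneq b (3 - n%:R).
  left; exists s.
  apply: table; rewrite /= ?A0 ?B0 ?c0 ?g0 ?b3 ?n1 ?n2 ?eqxx ?n_out ?andbF.
  - vring.
  - by rewrite ifT; [vring | lia].
  - by move=> i hi; rewrite ifN ?ifT; [congr (_ *: _); ring | lia | lia].
  - vring.
  - vring.
  - by move=> j hj; rewrite ifN //; lia.
  - vring.
right; exists b; first by rewrite !inE !negb_or b1 b2 b3 b4 b5.
have s0 : s = 0.
  by apply: factor0 sb _; rewrite (_ : _ - _ = b - (3 - n%:R)) ?subr_eq0 //; ring.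
apply: table; rewrite /= ?A0 ?B0 ?c0 ?s0 ?g0 ?n1 ?n2 ?eqxx ?n_out ?andbF.
- vring.
- by rewrite ifT; [vring | lia].
- by move=> i hi; rewrite ifN ?ifT; [congr (_ *: _); ring | lia | lia].
- vring.
- vring.
- by move=> j hj; rewrite ifN //; lia.
- vring.
Qed.

End Frames.

(** * From the nilradical to a frame and an outer element *)

(** Only [x, x] needs an argument. Write it as y + c x with y in N; then [x, [x, x]] = 0 gives c
    [x, x] = - [x, y], which lies in N. *)
Lemma ideal_absorbs (K : fieldType) (L : leibnizType K) (N : {vspace L}) (x : L) :
    leibniz_ideal N -> x \notin N -> (forall v, exists c, v - c *: x \in N) ->
  forall u v, [lb u, v] \in N.
Proof.
move=> idN xN Lx u v.
have lbN y w : y \in N -> [lb y, w] \in N by move=> yN; case: (idN y w yN).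
have Nlb y w : y \in N -> [lb w, y] \in N by move=> yN; case: (idN y w yN).
have xxN : [lb x, x] \in N.
  have [c xxc] := Lx [lb x, x]; have := lb_sqr0 x x.
  rewrite -{1}(subrK (c *: x) [lb x, x]) lbDr lbZr.
  have [c0|c0] := eqVneq c 0; first by move: xxc; rewrite c0 scale0r subr0.
  move/eqP; rewrite addrC addr_eq0 => /eqP cxx.
  by rewrite -[[lb x, x]](scalerK c0) cxx memvZ // memvN Nlb.
have [[c uN] [d vN]] := (Lx u, Lx v).
rewrite -(subrK (c *: x) u) -(subrK (d *: x) v).
move: (u - _) (v - _) uN vN => p q pN qN; rewrite !lbDl !lbDr !lbZl !lbZr.
by rewrite !memvD ?memvZ ?xxN ?(lbN p) ?(Nlb q).
Qed.

Lemma M10_basis_of (K : fieldType) (n : nat) (n_ge6 : (6 <= n)%N) :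
  basis_of {:M10 K n n_ge6} [seq M10_basis K n i | i <- iota 1 n].
Proof.
rewrite basisEdim size_map size_iota dimvf /dim /= mul1n leqnn andbT.
apply/subvP => v _; rewrite (row_sum_delta v) memv_suml // => j _.
apply/memvZ/memv_span; have -> : delta_mx 0 j = M10_basis K n j.+1.
  by apply/rowP => k; rewrite !mxE eqxx eqSS.
by apply: map_f; rewrite mem_iota; have := ltn_ord j; lia.
Qed.

Lemma subalg_isomorphic_frame (K : numFieldType) (n : nat) (n_ge6 : (6 <= n)%N)
    (L : leibnizType K) (N : {vspace L}) :
  subalg_isomorphic N (M10 K n n_ge6) -> exists e, M10_frame n N e.
Proof.
move=> [f [kerf imf fM]]; exists (fun i => f (M10_basis K n i)); split.
  rewrite -imf (map_comp f) limg_basis_of ?M10_basis_of //.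
  by rewrite kerf capv0.
move=> i j hi hj; rewrite -fM.
rewrite [[lb _, _]](_ : _ = M10_prod n (M10_basis K n) i j); last exact: M10_lbrE.
rewrite /M10_prod; case: ifP => _; last by rewrite linear0.
by case: ifP => // _; case: ifP => // _; rewrite linear0.
Qed.

Lemma vspace_codim1 (K : fieldType) (L : vectType K) (N : {vspace L}) (x : L) :
  \dim {:L} = (\dim N).+1 -> x \notin N -> forall v, exists c, v - c *: x \in N.
Proof.
move=> dimL xN v.
have : v \in (N + <[x]>)%VS.
  suff -> : (N + <[x]>)%VS = fullv by exact: memvf.
  apply/eqP; rewrite eqEdim subvf dimL /= ltn_neqAle dimvS ?addvSl // andbT.
  apply: contra xN => /eqP dimN.
  have /eqP -> : N == (N + <[x]>)%VS by rewrite eqEdim addvSl -dimN /=.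
  by rewrite memvE addvSr.
case/memv_addP => u uN [w /vlineP[c ->] ->]; exists c.
by rewrite addrK.
Qed.

Theorem theorem3p4 (R : realType) (n : nat) (n_ge6 : (6 <= n)%N)
    (L : leibnizType (complex R)) (N : {vspace L})
    (dimL : \dim {:L} = n.+1)
    (solL : leibniz_solvable {:L}%VS)
    (nilN : leibniz_nilradical N)
    (isoN : subalg_isomorphic N (M10 (complex R) n n_ge6)) :
  exists (e : nat -> L) (x : L),
    (exists a : nat -> complex R, basis_with_products n e x (R1_table n e a)) \/
    (exists a : complex R, basis_with_products n e x (R2_table n e a)) \/
    (exists a : complex R, basis_with_products n e x (R3_table n e a)) \/
    (exists a : complex R, basis_with_products n e x (R4_table n e a)) \/
    (exists a : complex R, basis_with_products n e x (R5_table n e a)) \/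
    (exists a : complex R, basis_with_products n e x (R6_table n e a)) \/
    (exists2 a : complex R,
       a \notin [:: 1; 2; 3 - n%:R; 4 - n%:R; 5 - n%:R]
       & basis_with_products n e x (R7_table n e a)).
Proof.
have [e0 fr0] := subalg_isomorphic_frame isoN.
have dimN : \dim {:L} = (\dim N).+1 by rewrite dimL (size_basis (frame_basis fr0)).
have [x0 x0N] : exists x, x \notin N.
  have /subvPn[x _ xN] : ~~ ({:L} <= N)%VS.
    by apply/negP => /dimvS; rewrite dimN ltnn.
  by exists x.
have [idN _ _] := nilN.
have Nabs := ideal_absorbs idN x0N (vspace_codim1 dimN x0N).
have := nonnilpotent_ext n_ge6 Nabs fr0 nilN x0N (vspace_codim1 dimN x0N).
set a1 := co _ _ 1 _; set b := co _ _ 2 _.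
have scale_notin (c : complex R) : c != 0 -> c *: x0 \notin N.
  by move=> c0; apply: contra x0N => /(memvZ c^-1); rewrite scalerK.
(* The weights are linear in x: dividing x by b if a = 0, and by a otherwise, normalises them to (0,
   1) or (1, b / a). *)
have [a10 /= b0|a10 _] := eqVneq a1 0.
  have bx : co n_ge6 e0 2 [lb e0 2%N, b^-1 *: x0] = 1.
    by rewrite lbZr linearZ /= -/b mulVf.
  have ax : co n_ge6 e0 1 [lb e0 1%N, b^-1 *: x0] = 0.
    by rewrite lbZr linearZ /= -/a1 a10 mulr0.
  have [e [a [fr De1 b1 bn]]] := zero_weight_frame Nabs fr0 ax bx.
  have xN := scale_notin _ (invr_neq0 b0).
  have [x [a' [s [x'N De1' [b1' bn'] xe xx]]]] := zero_weight_ext Nabs fr xN De1 b1 bn.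
  exists e, x; left; exact (R1_table_products Nabs fr x'N dimL De1' b1' bn' xe xx).
have ax : co n_ge6 e0 1 [lb e0 1%N, a1^-1 *: x0] = 1.
  by rewrite lbZr linearZ /= -/a1 mulVf.
have xN := scale_notin _ (invr_neq0 a10).
have [e1 [g1 [fr1 ax1 De2 Dei]]] := diagonal_frame Nabs fr0 ax.
have [e [A [B [g [fr De1 De2' Dei' [Ab Bb gb]]]]]] := resonant_frame Nabs fr1 ax1 De2 Dei.
have [x [c [s [x'N xR [xe1 xe] xx [cb sb]]]]] :=
  nonzero_weight_ext n_ge6 Nabs fr xN De1 De2' Dei' gb.
have eN i : (1 <= i <= n)%N -> e i \in N by exact: frame_mem.
exists e, x; right; apply: (R2_7_table_products n_ge6 Nabs fr x'N dimL _ _ _ xe1 xe xx Ab Bb gb cb sb).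
- by rewrite xR ?eN //; lia.
- by rewrite xR ?eN //; lia.
- by move=> i hi; rewrite xR ?Dei' ?eN //; lia.
Qed.
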